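(* Let $|A|=n\ge 2$, $k\ge 1$, fix $r\in[1,k]$ and let $S=[1,k]\setminus\{r\}$. As an $S_n$-module, $$\tilde H_{k-2}(A^*_{n,k}(S))\simeq \left[\binom{k}{r}-1\right] S_{(n-1,1)}^{\otimes k}\ \oplus\ \binom{k}{r}\, S_{(n-1,1)}^{\otimes (k-1)}.$$
   Context: $A^*$ is the set of all finite words in the alphabet $A$, $|A|=n$, including the empty word, ordered by the subword order: $u\le v$ if $u$ is obtained from $v$ by deleting letters (not necessarily consecutive). The rank of a word is its length. For $S\subseteq[1,k]=\{1,\dots,k\}$, $A^*_{n,k}(S)$ is the subposet of words with length in $S$; its homology means the reduced simplicial homology, with complex coefficients, of its order complex (any attached bottom or top element is removed first; the empty complex has reduced homology $\mathbb{C}$ in degree $-1$). $S_n$ acts by permuting the letters of $A$. $S_{(n-1,1)}$ is the irreducible complex $S_n$-module indexed by $(n-1,1)$; its $0$th tensor power is the trivial module; $b\,V$ denotes a direct sum of $b$ copies of $V$. *)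

(* Defs.v *)
From HB Require Import structures.
From mathcomp Require Import all_boot all_order all_fingroup all_algebra.
From mathcomp Require Import all_solvable all_character.

Set Implicit Arguments.
Unset Strict Implicit.
Unset Printing Implicit Defensive.

Import Order.TTheory GRing.Theory GroupScope.
Local Open Scope ring_scope.

(* Permutations act on the right in MathComp ((s * t) x = t (s x)), and a
   representation acts on row vectors by right multiplication; a right module
   over S_n with this product is a left module over S_n with the usual one.   *)

Section PermutationModule.

Variables (F : fieldType) (gT : finGroupType) (T : finType).
Variable to : {action gT &-> T}.

Definition perm_repr_mx (g : gT) : 'M[F]_#|T| :=
  \matrix_(i, j) (to (enum_val i) g == enum_val j)%:R.

Lemma mul_perm_repr_mx p g (A : 'M[F]_(#|T|, p)) i j :
  (perm_repr_mx g *m A) i j = A (enum_rank (to (enum_val i) g)) j.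
Proof.
rewrite mxE (bigD1 (enum_rank (to (enum_val i) g))) //= mxE enum_rankK eqxx.
rewrite mul1r big1 ?addr0 // => k nek; rewrite mxE -(inj_eq enum_rank_inj).
by rewrite enum_valK eq_sym (negPf nek) mul0r.
Qed.

Lemma perm_repr_mx_repr : mx_repr [set: gT] perm_repr_mx.
Proof.
split=> [|g h _ _]; apply/matrixP=> i j.
  by rewrite !mxE act1 (inj_eq enum_val_inj).
by rewrite mul_perm_repr_mx !mxE enum_rankK actM.
Qed.

Definition perm_repr : mx_representation F [set: gT] #|T| :=
  MxRepresentation perm_repr_mx_repr.

End PermutationModule.

Section TensorPower.

Variables (F : fieldType) (gT : finGroupType) (G : {group gT}).

Lemma triv_mx_repr : mx_repr G (fun _ : gT => 1%:M : 'M[F]_1).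
Proof. by split=> // g h _ _; rewrite mulmx1. Qed.

Definition triv_grepr : representation F G :=
  Representation (MxRepresentation triv_mx_repr).

Fixpoint tens_grepr (V : representation F G) (k : nat) : representation F G :=
  if k is k'.+1 then Representation (prod_repr V (tens_grepr V k'))
  else triv_grepr.

End TensorPower.

(* The cells of the Young diagram of la are numbered 0, ..., n - 1 along the
   rows, where n = sumn la; reshape_index and reshape_offset give the row and
   the column of a cell. A tabloid is the tuple of the sets of entries of its
   rows. As any two polytabloids are permuted by S_n, the Specht module is
   generated by that of the tableau with i in cell i.                         *)
Section Specht.

Variables (F : fieldType) (n : nat) (la : seq nat).

Definition tabloid0 : (size la).-tuple {set 'I_n} :=
  [tuple [set i : 'I_n | reshape_index la i == r] | r < size la].

Definition column_stabiliser : {set 'S_n} :=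
  [set q : 'S_n | [forall i, reshape_offset la (q i) == reshape_offset la i]].

Definition tabloid_repr : mx_representation F [set: 'S_n] _ :=
  perm_repr F ('P^* * size la)%act.

Definition polytabloid0 : 'rV[F]_#|{: (size la).-tuple {set 'I_n}}| :=
  \sum_(q in column_stabiliser)
     (-1) ^+ q *: delta_mx 0 (enum_rank (('P^* * size la)%act tabloid0 q)).

Definition specht : representation F [set: 'S_n] :=
  Representation (submod_repr (cyclic_mx_module tabloid_repr polytabloid0)).

End Specht.

Section OrderComplex.

Variables (F : fieldType) (disp : Order.disp_t) (P : finPOrderType disp).

(* The faces of the order complex with m vertices, i.e. of dimension m - 1,
   each listed in increasing order; the empty face is the one with m = 0.     *)
Definition chain (m : nat) := {c : m.-tuple P | sorted <%O c}.

HB.instance Definition _ m := Finite.on (chain m).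

Definition face (l : nat) (c : seq P) : seq P := take l c ++ drop l.+1 c.

(* The augmented simplicial boundary, acting on row vectors on the right; on
   chains with m = 0 (degree -1) it vanishes, the sum being empty.            *)
Definition incidence m (c : chain m) (c' : chain m.-1) : F :=
  \sum_(l < m | face l (val c) == val c' :> seq P) (-1) ^+ l.

Definition boundary (m : nat) : 'M[F]_(#|{: chain m}|, #|{: chain m.-1}|) :=
  \matrix_(i, j) incidence (enum_val i) (enum_val j).

Lemma size_face l c : (l < size c)%N -> size (face l c) = (size c).-1.
Proof.
move=> lc; rewrite size_cat size_take lc size_drop.
by rewrite -[in RHS](subnKC lc) addSn.
Qed.

Lemma face_sorted l (c : seq P) : sorted <%O c -> sorted <%O (face l c).
Proof.
apply: subseq_sorted; first exact: lt_trans.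
rewrite -[X in subseq _ X](cat_take_drop l) cat_subseq //.
by rewrite -add1n -drop_drop; apply: drop_subseq.
Qed.

Lemma face_face (a b : nat) (c : seq P) :
  (b <= a)%N -> face b (face a.+1 c) = face a (face b c).
Proof.
elim: c a b => [|x c IHc] [|a] [|b] //= ba; rewrite /face /=.
- by rewrite !drop0.
- by rewrite !drop0.
by congr (_ :: _); apply: IHc.
Qed.

Lemma boundary_boundary m : boundary m.+1 *m boundary m = 0.
Proof.
case: m => [|m].
  apply/matrixP=> i j; rewrite !mxE big1 // => k _.
  by rewrite [boundary 0 _ _]mxE /incidence big_ord0 mulr0.
apply/matrixP=> i j; rewrite mxE [RHS]mxE /=.
set s := val (enum_val i); set t := val (enum_val j).
pose f (a b : nat) : F := if face b (face a s) == t then (-1) ^+ (a + b) else 0.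
transitivity (\sum_(a < m.+2) \sum_(b < m.+1) f a b).
  under eq_bigr => k _ do rewrite mxE /incidence big_mkcond mulr_suml.
  rewrite exchange_big; apply: eq_bigr => a _ /=.
  have fs : size (face a s) == m.+1 by rewrite size_face ?size_tuple.
  have fS : sorted <%O (Tuple fs) by apply: face_sorted; apply: (valP (enum_val i)).
  pose c : chain m.+1 := exist _ (Tuple fs) fS.
  rewrite (bigD1 (enum_rank c)) //= enum_rankK eqxx [X in _ + X]big1 ?addr0.
    rewrite mxE enum_rankK /incidence mulr_sumr big_mkcond; apply: eq_bigr => b _.
    by rewrite /f exprD; case: ifP.
  move=> k nek; case: ifP => [/eqP Ek|]; last by rewrite mul0r.
  case/eqP: nek; apply: enum_val_inj; rewrite enum_rankK.
  by do 2![apply: val_inj].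
have E a b : (b <= a)%N -> f a.+1 b = - f b a.
  move=> ba; rewrite /f face_face //; case: ifP; rewrite ?oppr0 // => _.
  by rewrite addSn exprS mulN1r addnC.
rewrite (eq_bigr (fun a : 'I_m.+2 => \sum_(b < m.+1 | (b < a)%N) f a b
   + \sum_(b < m.+1 | ~~ (b < a)%N) f a b)); last first.
  by move=> a _; rewrite (bigID (fun b : 'I_m.+1 => (b < a)%N)).
rewrite big_split /= big_ord_recl /= big_pred0 // add0r.
rewrite [X in _ + X]big_ord_recr /= [X in _ + (_ + X)]big_pred0 ?addr0; last first.
  by move=> b; rewrite ltn_ord.
rewrite (exchange_big_dep predT) //= -big_split big1 //= => b _.
rewrite [X in _ + X](eq_bigl (fun a : 'I_m.+1 => (b <= a)%N)); last first.
  by move=> a; rewrite -leqNgt.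
rewrite [X in X + _](eq_bigl (fun a : 'I_m.+1 => (b <= a)%N)) //.
by rewrite -big_split big1 //= => a ba; rewrite E // addNr.
Qed.

Section Action.

Variables (gT : finGroupType) (to : {action gT &-> P}).
Hypothesis to_mono : forall g, {homo to^~ g : x y / x < y}%O.

Fact chain_act_sorted m (c : chain m) g :
  sorted <%O (map_tuple (to^~ g) (val c)).
Proof. exact: homo_sorted (to_mono g) _ (valP c). Qed.

Definition chain_act m (c : chain m) (g : gT) : chain m :=
  exist _ (map_tuple (to^~ g) (val c)) (chain_act_sorted c g).

Fact chain_act_is_action m : is_action [set: gT] (@chain_act m).
Proof.
apply: is_total_action => [c|c g h]; do 2!apply: val_inj => /=.
  by rewrite (eq_map (act1 to)) map_id.
by rewrite -map_comp; apply: eq_map => x; rewrite /= actM.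
Qed.

Definition chain_action m : {action gT &-> chain m} :=
  Action (@chain_act_is_action m).

Definition chain_repr m : mx_representation F [set: gT] #|{: chain m}| :=
  perm_repr F (chain_action m).

Lemma chain_repr_boundary m g :
  chain_repr m g *m boundary m = boundary m *m chain_repr m.-1 g.
Proof.
apply/matrixP=> i j; rewrite mul_perm_repr_mx [LHS]mxE [RHS]mxE.
pose j' := enum_rank (chain_action m.-1 (enum_val j) g^-1%g).
rewrite (bigD1 j') //= big1 ?addr0 => [|k nek]; last first.
  rewrite [X in _ * X]mxE -(inj_eq (act_inj (chain_action m.-1) g^-1%g)).
  by rewrite actK -(inj_eq enum_rank_inj) enum_valK (negPf nek) mulr0.
rewrite [X in _ * X]mxE /j' !enum_rankK actKV eqxx mulr1.
rewrite !mxE !enum_rankK /incidence.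
apply: eq_bigl => l; rewrite /face /= -map_drop -map_take -map_cat.
have inj := inj_map (act_inj to g); rewrite -[RHS](inj_eq inj).
by rewrite -[in RHS]map_comp (eq_map (actKV to g)) map_id.
Qed.

Lemma cycles_module m : mxmodule (chain_repr m) (kermx (boundary m)).
Proof.
apply/mxmoduleP=> g _; apply/sub_kermxP.
by rewrite -mulmxA chain_repr_boundary mulmxA mulmx_ker mul0mx.
Qed.

Lemma boundaries_module m :
  mxmodule (chain_repr m) <<boundary m.+1>>%MS.
Proof.
rewrite (eqmx_module _ (genmxE _)); apply/mxmoduleP=> g _.
by rewrite -(chain_repr_boundary m.+1) submxMl.
Qed.

(* The representation on the reduced homology in degree m - 1 (faces with m
   vertices): section_repr modU modV is the quotient module V / U.            *)
Definition reduced_homology_repr (m : nat) : representation F [set: gT] :=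
  Representation (section_repr (boundaries_module m) (cycles_module m)).

End Action.

End OrderComplex.

(* The bound k only serves to make the type finite: S is meant to be a set of
   ranks contained in [0, k].                                                 *)
Definition words (n k : nat) (S : pred nat) :=
  {w : k.-bseq 'I_n | size w \in S}.

Section Words.

Variables (n k : nat) (S : pred nat).

HB.instance Definition _ := Finite.on (words n k S).

Definition subword (u v : words n k S) := subseq (val u) (val v).

Fact subword_refl : reflexive subword.
Proof. by move=> u; apply: subseq_refl. Qed.

Fact subword_anti : antisymmetric subword.
Proof.
move=> u v /andP[uv vu]; do 2!apply: val_inj.
by apply: subseq_anti; apply/andP.
Qed.

Fact subword_trans : transitive subword.
Proof. by move=> v u w; apply: subseq_trans. Qed.

Fact subword_display : Order.disp_t. Proof. exact: Order.Disp tt tt. Qed.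

HB.instance Definition _ :=
  Order.Le_isPOrder.Build subword_display (words n k S)
    subword_refl subword_anti subword_trans.

Fact word_act_size (w : words n k S) (s : 'S_n) :
  size (map_bseq s (val w)) \in S.
Proof. by rewrite size_map; apply: (valP w). Qed.

Definition word_act (w : words n k S) (s : 'S_n) : words n k S :=
  exist _ (map_bseq s (val w)) (word_act_size w s).

Fact word_act_is_action : is_action [set: 'S_n] word_act.
Proof.
apply: is_total_action => [w|w s t]; do 2!apply: val_inj => /=.
  by rewrite (eq_map (@perm1 _)) map_id.
by rewrite -map_comp; apply: eq_map => x; rewrite /= permM.
Qed.

Definition word_action : {action 'S_n &-> words n k S} :=
  Action word_act_is_action.

Lemma word_action_mono (s : 'S_n) :
  {homo word_action^~ s : u v / u < v}%O.
Proof.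
move=> u v; rewrite !lt_neqAle (inj_eq (act_inj word_action s)).
by case/andP=> -> uv; apply: map_subseq.
Qed.

End Words.

(* Main.v *)
Require Import Defs.
From HB Require Import structures.
From mathcomp Require Import all_boot all_order all_fingroup all_algebra.
From mathcomp Require Import all_solvable all_character.
From mathcomp Require Import reals complex.
From mathcomp Require Import ring.

(* Over a field of characteristic 0 a representation is determined by its
   trace. All homology below the top degree vanishes, so by the Hopf trace
   formula the trace of [s] on the top homology is, up to sign, the reduced
   Euler characteristic of the subposet of the words fixed by [s]. These are
   the words over the [f] fixed letters of [s], so with [q = f - 1], the trace
   of [s] on S_(n-1,1), what remains is to evaluate this Euler characteristic
   as a polynomial in [q]. The number of words of length [m] over [f] letters
   containing a given word of length [l] is the sum of the coefficients of
   index at least [l] of (X + q)^m; this inverts the recursion for the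
   alternating numbers of chains above a word.

   Vanishing: the order complex of all nonempty words of length at most [k] is
   built from cones by adding vertices whose links are already known to be
   highly connected, and the same holds for open intervals. If [w = w'a], then
   appending [a] to the words that do not end in [a] is a closure operator; it
   retracts the interval (u, w) minus [w'] to a cone, or to a copy of (u', w')
   if [u = u'a]. The words of length [r] are deleted at the end: their links are joins
   of an interval and an upper set. *)

Set Implicit Arguments.
Unset Strict Implicit.
Unset Printing Implicit Defensive.

Import Order.TTheory GRing.Theory GroupScope.
Local Open Scope ring_scope.

(** * Representations with equal traces *)

Section TraceSimilarity.

Variables (F : decFieldType) (gT : finGroupType) (G : {group gT}).
Hypothesis char0 : [pchar F] =i pred0.

Local Notation reprG := (mx_representation F G).

(** Traces of group ring elements are determined by those of group elements, so representations with
    equal characters can be compared on Wedderburn idempotents. *)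
Lemma mxtrace_gring_op n (rG : reprG n) A :
  \tr (gring_op rG A) =
    \sum_(i < gcard G) gring_row A 0 i * \tr (rG (enum_val i)).
Proof.
rewrite gring_opE /gring_mx /= mulmx_sum_row !linear_sum; apply: eq_bigr => i _.
by rewrite !linearZ /= rowK mxvecK.
Qed.

Let F'G : [pchar F]^'.-group G.
Proof. by apply/pgroupP=> p _ _; rewrite inE /= char0. Qed.

Let iG : irrType F G := DecSocleType (regular_repr F G).

Lemma mxtrace_gring_op_Socle n (rG : reprG n) A :
  let sG := DecSocleType rG in
  \tr (gring_op rG A) =
    \sum_(W : sG) \tr (gring_op (socle_repr W) A) *+ socle_mult W.
Proof.
move=> sG; have S1 : (Socle sG :=: 1%:M)%MS.
  by rewrite (reducible_Socle1 sG (mx_Maschke_pchar rG F'G)).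
rewrite mxtrace_gring_op.
under eq_bigr => i _.
  rewrite -(mxtrace_submod1 (Socle_module sG) S1) ?enum_valP //.
  rewrite mxtrace_Socle ?enum_valP // mulr_sumr.
  over.
rewrite exchange_big; apply: eq_bigr => W _ /=.
rewrite mxtrace_gring_op -sumrMnl; apply: eq_bigr => i _.
by rewrite mulrnAr.
Qed.

(** [Wedderburn_id i] acts as the identity on irreducibles of type [i] and kills all others. *)
Lemma mxtrace_gring_op_irr n (rG : reprG n) (i : iG) :
  mx_irreducible rG ->
  \tr (gring_op rG (Wedderburn_id i)) =
    if irr_comp iG rG == i then n%:R else 0.
Proof.
move=> irrG; have sim := rsim_irr_comp_pchar iG F'G irrG.
have -> : \tr (gring_op rG (Wedderburn_id i))
    = \tr (gring_op (irr_repr (irr_comp iG rG)) (Wedderburn_id i)).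
  rewrite !mxtrace_gring_op; apply: eq_bigr => j _.
  by rewrite (mxtrace_rsim sim) ?enum_valP.
case: eqP => [<- | /eqP ne_i]; last first.
  rewrite (irr_repr'_op0_pchar F'G (j := i)) ?mxtrace0 1?eq_sym //.
  exact: Wedderburn_id_mem.
by rewrite op_Wedderburn_id_pchar // mxtrace1 -(mxrank_rsim sim).
Qed.

(** Induction on the dimension. The idempotent of a simple constituent of [rG1] has a positive
    integer as trace on [rG1], hence a nonzero trace on [rG2], which therefore contains an
    isomorphic constituent; the Maschke complements again have equal traces. *)
Lemma mx_rsim_mxtrace n1 n2 (rG1 : reprG n1) (rG2 : reprG n2) :
  {in G, forall x, \tr (rG1 x) = \tr (rG2 x)} -> mx_rsim rG1 rG2.
Proof.
have natF0 m : ((m%:R : F) == 0) = (m == 0)%N by rewrite ((pcharf0P F).1 char0).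
have [m] := ubnP n1; elim: m n1 n2 rG1 rG2 => // m IHm n1 n2 rG1 rG2 le_m tr12.
have eq_n : n1 = n2.
  apply/eqP; move: (tr12 1%g (group1 G)); rewrite !repr_mx1 !mxtrace1.
  have [le12 | /ltnW le21] := leqP n1 n2.
    move/eqP; rewrite eq_sym -subr_eq0 -natrB // natF0 subn_eq0 => le21.
    by rewrite eqn_leq le12.
  move/eqP; rewrite -subr_eq0 -natrB // natF0 subn_eq0 => le12.
  by rewrite eqn_leq le12.
have [n1_0 | n1_gt0] := posnP n1.
  move: rG1 rG2 {tr12}; rewrite -eq_n n1_0 => rG1 rG2.
  by exists 0 => // [|x _]; rewrite ?flatmx0 // /row_free mxrank0.
have nz1 : (1%:M : 'M[F]_n1) != 0 by rewrite -mxrank_eq0 mxrank1 -lt0n.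
have [M simM _] := dec_mxsimple_exists (mxmodule1 rG1) nz1.
pose sG1 := DecSocleType rG1; pose sG2 := DecSocleType rG2.
have [W1 _] := Socle_iso sG1 simM.
pose i := irr_comp iG (socle_repr W1).
have: \tr (gring_op rG2 (Wedderburn_id i)) != 0.
  rewrite mxtrace_gring_op.
  under eq_bigr => j _ do rewrite -tr12 ?enum_valP //.
  rewrite -mxtrace_gring_op mxtrace_gring_op_Socle /=.
  rewrite (eq_bigr (fun W : sG1 => ((if irr_comp iG (socle_repr W) == i then
     \rank (socle_base W) else 0) * socle_mult W)%N%:R)); last first.
    move=> W _; rewrite mxtrace_gring_op_irr; last exact: socle_irr.
    by case: eqP; rewrite ?mul0rn // natrM mulr_natr.
  rewrite -natr_sum natF0 -lt0n (bigD1 W1) //= eqxx addn_gt0 muln_gt0.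
  have rW1 : (0 < \rank (socle_base W1))%N.
    by rewrite lt0n mxrank_eq0; have [_ -> _] := socle_simple W1.
  rewrite rW1 divn_gt0 // mxrankS // component_mx_id //.
  exact: socle_simple.
rewrite mxtrace_gring_op_Socle /= => nz2.
have [W2 eq_i]: exists W2 : sG2, irr_comp iG (socle_repr W2) = i.
  have [W2 /eqP eq_i | no2] := pickP (fun W : sG2 =>
      irr_comp iG (socle_repr W) == i); first by exists W2.
  case/eqP: nz2; rewrite big1 // => W _.
  by rewrite mxtrace_gring_op_irr ?no2 ?mul0rn //; apply: socle_irr.
have sim12 : mx_rsim (socle_repr W1) (socle_repr W2).
  have sim1 := rsim_irr_comp_pchar iG F'G (socle_irr W1).
  have sim2 := rsim_irr_comp_pchar iG F'G (socle_irr W2).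
  by rewrite eq_i in sim2; apply: mx_rsim_trans sim1 (mx_rsim_sym sim2).
pose mod1 := socle_module W1.
pose mod2 := socle_module W2.
have [V1 modV1 def1 dx1] := mx_Maschke_pchar rG1 F'G mod1 (submx1 _).
have [V2 modV2 def2 dx2] := mx_Maschke_pchar rG2 F'G mod2 (submx1 _).
pose full n (rG : reprG n) := rsim_submod1 (mxmodule1 rG) (eqmx_refl _).
have simV : mx_rsim (submod_repr modV1) (submod_repr modV2).
  apply: IHm => [|x Gx].
    rewrite -ltnS; apply: leq_trans le_m; rewrite ltnS.
    rewrite -[X in (_ < X)%N](mxrank1 F n1) -def1 (mxdirectP dx1) /=.
    rewrite -[X in (X < _)%N]add0n ltn_add2r lt0n mxrank_eq0.
    by have [_ -> _] := socle_simple W1.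
  have := tr12 x Gx.
  rewrite -(mxtrace_rsim (full _ rG1)) // -(mxtrace_rsim (full _ rG2)) //.
  rewrite -(mxtrace_dadd_mod mod1 modV1 (mxmodule1 rG1) def1 dx1) //.
  rewrite -(mxtrace_dadd_mod mod2 modV2 (mxmodule1 rG2) def2 dx2) //.
  rewrite (mxtrace_rsim (rG1 := submod_repr mod1) sim12) //.
  by move/addrI.
have sim1 := mx_rsim_dadd (rU := Representation (socle_repr W2))
  (rV := Representation (submod_repr modV2)) (mxmodule1 rG1) def1 dx1
  sim12 simV.
have sim2 := mx_rsim_dadd (rU := Representation (socle_repr W2))
  (rV := Representation (submod_repr modV2)) (mxmodule1 rG2) def2 dx2
  (mx_rsim_refl _) (mx_rsim_refl _).
apply: mx_rsim_trans (mx_rsim_sym (full _ rG1)) _.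
apply: mx_rsim_trans sim1 _.
exact: mx_rsim_trans (mx_rsim_sym sim2) (full _ rG2).
Qed.

End TraceSimilarity.

(** * Traces along exact complexes *)

Section TraceExact.

Variables (F : fieldType) (gT : finGroupType) (G : {group gT}).
Local Notation reprG := (mx_representation F G).

(** The first isomorphism theorem: [B] lifts a coset of the kernel to a representative and applies
    [f]; by [killf] the choice of representative is immaterial. *)
Lemma mx_rsim_first_iso n1 n2 (rG1 : reprG n1) (rG2 : reprG n2) f (V : 'M_n2)
    (modK : mxmodule rG1 (kermx f)) (modV : mxmodule rG2 V) :
    {in G, forall x, rG1 x *m f = f *m rG2 x} -> (V :=: f)%MS ->
  mx_rsim (factmod_repr modK) (submod_repr modV).
Proof.
move=> homf defV; pose B := val_factmod (U := kermx f) 1%:M *m f.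
have killf m (W : 'M_(m, n1)) :
    val_factmod (in_factmod (kermx f) W) *m f = W *m f.
  rewrite -[in RHS](add_sub_fact_mod (kermx f) W) mulmxDl.
  by rewrite (sub_kermxP (val_submodP _)) add0r.
have sBV : (B <= V)%MS by rewrite defV submxMl.
have rankV : \rank V = \rank (cokermx (kermx f)).
  by rewrite mxrank_coker mxrank_ker defV subKn // rank_leq_row.
exists (in_submod V B) => [||x Gx]; first by rewrite rankV.
  rewrite /row_free mxrank_in_submod // eqn_leq rank_leq_row.
  rewrite -[X in (X <= _)%N]rankV defV.
  apply/mxrankS/submxP; exists (in_factmod (kermx f) 1%:M).
  by rewrite /B mulmxA -val_factmodE killf mul1mx.
rewrite -in_submodJ //.
have -> : B *m rG2 x = factmod_repr modK x *m B.
  transitivity (val_factmod (factmod_repr modK x) *m f).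
    by rewrite [RHS]killf /B -!mulmxA homf.
  by rewrite val_factmodE -mulmxA.
by rewrite [in LHS]in_submodE [in RHS]in_submodE mulmxA.
Qed.

Lemma mxtrace_ker_im n1 n2 (rG1 : reprG n1) (rG2 : reprG n2) f (V : 'M_n2)
    (modK : mxmodule rG1 (kermx f)) (modV : mxmodule rG2 V) x :
    {in G, forall x, rG1 x *m f = f *m rG2 x} -> (V :=: f)%MS -> x \in G ->
  \tr (rG1 x) = \tr (submod_repr modK x) + \tr (submod_repr modV x).
Proof.
move=> homf defV Gx; rewrite -(mxtrace_sub_fact_mod modK).
by rewrite (mxtrace_rsim (mx_rsim_first_iso modK modV homf defV)).
Qed.

Lemma mxtrace_submod0 n (rG : reprG n) U (modU : mxmodule rG U) x :
  U = 0 -> \tr (submod_repr modU x) = 0.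
Proof.
move=> U0; have : \rank U = 0%N by rewrite U0 mxrank0.
move: (submod_repr _ x) => A rU; apply: big1 => i _.
by have := ltn_ord i; rewrite [X in (_ < X)%N]rU.
Qed.

Lemma mxtrace_section0 n (rG : reprG n) U V
    (modU : mxmodule rG U) (modV : mxmodule rG V) x :
    U = 0 -> x \in G ->
  \tr (section_repr modU modV x) = \tr (submod_repr modV x).
Proof.
move=> U0 Gx; pose f := in_factmod U (val_submod (U := V) 1%:M).
have fM m (W : 'M_(m, \rank V)) : W *m f = in_factmod U (val_submod W).
  by rewrite val_submodE /f /in_factmod /= mulmxA.
have homf : {in G, forall x,
    submod_repr modV x *m f = f *m factmod_repr modU x}.
  move=> y Gy; rewrite fM -in_factmodJ //.
  by rewrite -[submod_repr _ _]mul1mx val_submodJ.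
have kerf0 : kermx f = 0.
  apply/eqP/rowV0P=> v /sub_kermxP; rewrite fM => /eqP.
  rewrite in_factmod_eq0 U0 submx0.
  by rewrite val_submod_eq0 => /eqP.
have modK : mxmodule (submod_repr modV) (kermx f).
  by rewrite kerf0 mxmodule0.
rewrite (mxtrace_ker_im modK (section_module modU modV) homf) //.
  by rewrite mxtrace_submod0 ?add0r.
apply: eqmx_trans (genmxE _) _.
exact/eqmxMr/eqmx_sym/val_submod1.
Qed.

End TraceExact.

(** * The Hopf trace formula *)

Section HopfTrace.

Variables (F : fieldType) (disp : Order.disp_t) (P : finPOrderType disp).
Variables (gT : finGroupType) (to : {action gT &-> P}).
Hypothesis to_mono : forall g, {homo to^~ g : x y / (x < y)%O}.

(** Exactness identifies the cycles with [m] vertices with the boundaries of chains with [m.+1]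
    vertices, so the trace on chains is the sum of the traces on two consecutive cycle modules;
    solving for the top one gives the alternating sum. *)
Lemma mxtrace_cycles m g :
    (forall j, (j < m)%N -> (kermx (boundary F P j) <= boundary F P j.+1)%MS) ->
  \tr (submod_repr (cycles_module F to_mono m) g) =
    \sum_(j < m.+1) (-1) ^+ (m + j) * \tr (chain_repr F to_mono j g).
Proof.
elim: m => [|m IHm] ex.
  rewrite big_ord1 mul1r; apply: mxtrace_submod1; last exact: in_setT.
  apply/eqmxP; rewrite submx1 andTb; apply/sub_kermxP; rewrite mul1mx.
  by apply/matrixP=> i j; rewrite !mxE /incidence big_ord0.
have hom : {in [set: gT], forall x,
    chain_repr F to_mono m.+1 x *m boundary F P m.+1 =
    boundary F P m.+1 *m chain_repr F to_mono m x}.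
  by move=> x _; apply: chain_repr_boundary.
have ker_im : (kermx (boundary F P m) :=: boundary F P m.+1)%MS.
  apply/eqmxP; rewrite ex // andTb; apply/sub_kermxP.
  exact: boundary_boundary.
have trC := mxtrace_ker_im (cycles_module F to_mono m.+1)
  (cycles_module F to_mono m) hom ker_im (in_setT g).
rewrite big_ord_recr trC addnn -muln2 exprM sqrr_sign mul1r.
under eq_bigr => j _ do rewrite addSn exprS mulN1r mulNr.
rewrite sumrN -IHm; last by move=> j jm; apply/ex/ltnW.
by rewrite /= addrCA addNr addr0.
Qed.

Lemma mxtrace_reduced_homology m g : #|{: chain P m.+1}| = 0%N ->
    (forall j, (j < m)%N -> (kermx (boundary F P j) <= boundary F P j.+1)%MS) ->
  \tr (reduced_homology_repr F to_mono m g) =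
    \sum_(j < m.+1) (-1) ^+ (m + j) * \tr (chain_repr F to_mono j g).
Proof.
move=> C0 ex; rewrite -mxtrace_cycles //.
apply: mxtrace_section0; last exact: in_setT.
apply/eqP; rewrite -mxrank_eq0 genmxE -leqn0 -[X in (_ <= X)%N]C0.
exact: rank_leq_row.
Qed.

End HopfTrace.

(** * Acyclicity of order complexes *)

Section Cochains.

Variables (R : nzRingType) (T : eqType) (lt : rel T).
Hypotheses (lt_trans : transitive lt) (lt_irr : irreflexive lt).

Implicit Types (f g : seq T -> R) (c s : seq T) (A B : pred T) (w x y : T).

(** Cochains are functions on all lists, of which only the values on chains matter. The recursion on
    the head yields the usual alternating sum over deletions of one entry. *)
Fixpoint coboundary f c : R :=
  if c is x :: t then f t - coboundary (fun s => f (x :: s)) t else 0.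

Lemma eq_coboundary f g c :
    (forall s, subseq s c -> (size s).+1 = size c -> f s = g s) ->
  coboundary f c = coboundary g c.
Proof.
elim: c f g => // x t IHt f g fg /=; rewrite fg ?subseq_cons //.
rewrite (IHt _ (fun s => g (x :: s))) // => s st sz.
by apply: fg; rewrite /= ?eqxx ?sz.
Qed.

Lemma coboundaryD f g c :
  coboundary (fun s => f s + g s) c = coboundary f c + coboundary g c.
Proof.
elim: c f g => /= [|x t IHt] f g; first by rewrite addr0.
by rewrite IHt opprD addrACA.
Qed.

Lemma coboundaryN f c : coboundary (fun s => - f s) c = - coboundary f c.
Proof.
elim: c f => /= [|x t IHt] f; first by rewrite oppr0.
by rewrite IHt opprD.
Qed.

Lemma coboundary0 c : coboundary (fun=> 0) c = 0.
Proof. by elim: c => //= x t ->; rewrite subrr. Qed.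

Lemma coboundaryK f c : coboundary (coboundary f) c = 0.
Proof.
elim: c f => //= x t IHt f.
by rewrite coboundaryD coboundaryN IHt subr0 subrr.
Qed.

Definition ischain A m c := [&& size c == m, sorted lt c & all A c].

Lemma ischain_sub A B m c : {subset A <= B} -> ischain A m c -> ischain B m c.
Proof.
move=> sAB /and3P[sz srt /allP Ac]; rewrite /ischain sz srt.
by apply/allP=> x /Ac /sAB.
Qed.

Definition adjacent x y := lt x y || lt y x.

Definition below w c := [seq x <- c | lt x w].
Definition insert w c := below w c ++ w :: [seq x <- c | ~~ lt x w].

(* The restriction of [f] to the simplices through [w], as a cochain on the
   link of [w]; the sign moves [w] to the front. *)
Definition at_vertex w f c : R := (-1) ^+ size (below w c) * f (insert w c).

(** Deleting [w] gives the first term; every other face contains [w] and is a value of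
    [at_vertex w f], up to the sign of moving [w] to the front. *)
Lemma coboundary_insert_cat w f c1 c2 :
    all (lt^~ w) c1 -> all (fun x => ~~ lt x w) c2 ->
  coboundary f (c1 ++ w :: c2) = (-1) ^+ size c1 *
    (f (c1 ++ c2) - coboundary (at_vertex w f) (c1 ++ c2)).
Proof.
move=> + Hc2; elim: c1 f => [|x c1 IHc1] f /=; last case/andP=> xw Hc1.
  move=> _; rewrite mul1r; congr (_ + - _); apply: eq_coboundary => s sc _.
  have /allP Hs : all (fun x => ~~ lt x w) s.
    by apply/allP=> x /(mem_subseq sc); apply/allP: x.
  rewrite /at_vertex /insert; have -> : below w s = [::].
    by apply/eqP; rewrite -[_ == _]negbK -has_filter; apply/hasPn.
  by rewrite (all_filterP _) ?mul1r //; apply/allP.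
have szc1 : below w (c1 ++ c2) = c1.
  rewrite /below filter_cat (all_filterP Hc1) -[RHS]cats0; congr cat.
  by apply/eqP; rewrite -[_ == _]negbK -has_filter; apply/hasPn/allP.
have hi : [seq x <- c1 ++ c2 | ~~ lt x w] = c2.
  rewrite filter_cat (all_filterP Hc2) -[RHS]cat0s; congr cat.
  apply/eqP; rewrite -[_ == _]negbK -has_filter; apply/hasPn => y.
  by move/(allP Hc1) => ->.
have -> : coboundary (fun s => at_vertex w f (x :: s)) (c1 ++ c2)
    = - coboundary (at_vertex w (fun s => f (x :: s))) (c1 ++ c2).
  rewrite -coboundaryN; apply: eq_coboundary => s _ _.
  by rewrite /at_vertex /insert /below /= xw /= exprS mulN1r mulNr.
rewrite (IHc1 _ Hc1) {2}/at_vertex /insert szc1 hi exprS mulN1r mulNr opprK.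
set d := coboundary _ _; set a := f (x :: _); set b := f _; set e := _ ^+ _.
rewrite opprD addrCA [in RHS]mulrDr opprD mulrN opprK.
by rewrite mulrA /e -expr2 sqrr_sign mul1r.
Qed.

Lemma sorted_below w c :
  sorted lt c -> c = below w c ++ [seq x <- c | ~~ lt x w].
Proof.
elim: c => //= x c IHc; rewrite path_sortedE // => /andP[/allP xc srt].
case xw: (lt x w) => /=; first by congr cons; apply: IHc.
have noc y : y \in c -> lt y w = false.
  by move=> yc; apply: contraFF xw; apply: lt_trans; apply: xc.
rewrite [below w c](eq_in_filter (a2 := pred0)) //= filter_pred0.
by rewrite (eq_in_filter (a2 := predT)) ?filter_predT // => y /noc /= ->.
Qed.

Lemma coboundary_insert w f c : sorted lt c ->
  coboundary f (insert w c) = (-1) ^+ size (below w c) *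
    (f c - coboundary (at_vertex w f) c).
Proof.
move=> srt; rewrite coboundary_insert_cat ?filter_all //.
by rewrite -sorted_below.
Qed.

(** The cone homotopy: the restriction of [f] to the link of [w] serves as a local primitive of
    [f]. *)
Lemma coboundary_at_vertex w f c : sorted lt c ->
  coboundary f (insert w c) = 0 -> f c = coboundary (at_vertex w f) c.
Proof.
move=> srt; rewrite coboundary_insert //.
move/(congr1 ( *%R ((-1) ^+ size (below w c)))).
by rewrite mulr0 mulrA -expr2 sqrr_sign mul1r => /subr0_eq.
Qed.

Lemma perm_insert w c : perm_eq (insert w c) (w :: c).
Proof.
rewrite /insert -cat1s perm_catCA /= perm_cons.
by rewrite perm_filterC.
Qed.

Lemma mem_insert w c x : (x \in insert w c) = (x == w) || (x \in c).
Proof. by rewrite (perm_mem (perm_insert w c)) in_cons. Qed.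

Lemma ischain_insert A m w c : A w -> all (adjacent w) c ->
  ischain A m c -> ischain A m.+1 (insert w c).
Proof.
move=> Aw /allP wc /and3P[/eqP sz srt /allP Ac]; apply/and3P; split.
- by rewrite (perm_size (perm_insert w c)) /= sz.
- move: (srt); rewrite {1}(sorted_below w srt) !(sorted_pairwise lt_trans).
  rewrite !pairwise_cat allrel_consr /= => /and3P[-> -> ->]; rewrite !andbT.
  apply/andP; split; first exact: filter_all.
  apply/allP=> x; rewrite mem_filter => /andP[xw xc].
  by have /orP[] := wc _ xc; rewrite // (negPf xw).
by apply/allP=> x; rewrite mem_insert => /predU1P[-> // | /Ac].
Qed.

Lemma chain_through w m A c : ischain A m c -> w \in c ->
  exists c', [/\ c = insert w c', ischain (predI A (adjacent w)) m.-1 c',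
       w \notin c' & m = m.-1.+1].
Proof.
move=> /and3P[/eqP sz srt /allP Ac] wc.
set c' := [seq x <- c | x != w]; exists c'.
have [c1 [c2 def_c]] : exists c1 c2, c = c1 ++ w :: c2.
  by case/splitPr: wc => c1 c2; exists c1, c2.
move: srt sz; rewrite {1 2}def_c (sorted_pairwise lt_trans) pairwise_cat.
rewrite allrel_consr /= -!andbA.
case/and5P=> /allP c1w c12 pw1 /allP wc2 pw2 sz.
have def_c' : c' = c1 ++ c2.
  rewrite /c' def_c filter_cat /= eqxx /=.
  congr (_ ++ _); apply/all_filterP/allP.
    by move=> y /c1w; apply: contraTneq => ->; rewrite lt_irr.
  by move=> y /wc2; apply: contraTneq => ->; rewrite lt_irr.
have wc' : w \notin c' by rewrite mem_filter eqxx.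
have lo : below w c' = c1.
  rewrite /below def_c' filter_cat (all_filterP _) ?(introT allP) //.
  rewrite -[RHS]cats0; congr cat; apply/eqP; rewrite -[_ == _]negbK -has_filter.
  apply/hasPn=> y /wc2 wy; apply: contraFN (lt_irr w) => yw.
  exact: lt_trans wy yw.
have hi : [seq x <- c' | ~~ lt x w] = c2.
  rewrite def_c' filter_cat -[RHS]cat0s; congr cat.
    apply/eqP; rewrite -[_ == _]negbK -has_filter; apply/hasPn=> y /c1w.
    by rewrite negbK.
  apply/all_filterP/allP=> y /wc2 wy; apply: contraFN (lt_irr w) => yw.
  exact: lt_trans wy yw.
split=> //; first by rewrite /insert lo hi def_c.
  apply/and3P; split.
  - by rewrite -sz def_c' !size_cat /= addnS.
  - by rewrite (sorted_pairwise lt_trans) def_c' pairwise_cat c12 pw1.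
  apply/allP=> x; rewrite def_c' mem_cat => xc; apply/andP; split.
    by apply: Ac; rewrite def_c mem_cat in_cons orbCA xc orbT.
  by apply/orP; case/orP: xc => [/c1w | /wc2]; [right | left].
by rewrite -sz size_cat /= addnS.
Qed.

Lemma subseq_notin w s c : subseq s c -> w \notin c -> w \notin s.
Proof. by move=> sc; apply: contra => /(mem_subseq sc). Qed.

(** A section of [at_vertex]: it turns a cochain on the link of [w] into one on the simplices
    through [w]. *)
Definition extend_vertex w f c : R :=
  (-1) ^+ size (below w c) * f [seq x <- c | x != w].

Lemma at_vertex_extend w f g c : sorted lt c -> w \notin c ->
    g (insert w c) = extend_vertex w f (insert w c) ->
  at_vertex w g c = f c.
Proof.
move=> srt wc; rewrite /at_vertex => ->; rewrite /extend_vertex.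
have -> : below w (insert w c) = below w c.
  rewrite /below /insert filter_cat /= lt_irr filter_id -filter_predI.
  rewrite [X in _ ++ X](eq_filter (a2 := pred0)) ?filter_pred0 ?cats0 //.
  by move=> x /=; case: (lt x w).
rewrite mulrA -expr2 sqrr_sign mul1r; congr f.
rewrite filter_cat /= eqxx /= -filter_cat -sorted_below //.
by apply/all_filterP/allP=> x xc; apply: contraNneq wc => <-.
Qed.

(* The order complex of [A] has no reduced cohomology in the degrees below
   [d - 1]; a chain with [m] elements has degree [m - 1]. *)
Definition acyclic (d : nat) A := forall m f, (m < d)%N ->
    (forall c, ischain A m.+1 c -> coboundary f c = 0) ->
  exists g, forall c, ischain A m c -> f c = coboundary g c.

Lemma acyclic_leq d e A : (d <= e)%N -> acyclic e A -> acyclic d A.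
Proof. by move=> de He m f md; apply: He; apply: leq_trans de. Qed.

Lemma acyclic_ext d A B : A =1 B -> acyclic d A -> acyclic d B.
Proof.
move=> AB HA m f md df.
have [|g fg] := HA m f md.
  by move=> c Ac; apply/df/(ischain_sub _ Ac) => x; rewrite !unfold_in AB.
exists g => c Bc; apply/fg/(ischain_sub _ Bc) => x.
by rewrite !unfold_in AB.
Qed.

(** The primitive is the cone homotopy off [a] and zero on chains through [a]; such a chain has just
    one face avoiding [a], and that face recovers [f]. *)
Lemma acyclic_cone d A a :
  A a -> (forall x, A x -> x != a -> adjacent a x) -> acyclic d A.
Proof.
move=> Aa cmp m f _ df; pose g c := if a \in c then 0 else at_vertex a f c.
have da c : ischain A m c -> a \notin c -> f c = coboundary (at_vertex a f) c.
  move=> cA ac; apply: coboundary_at_vertex; first by case/and3P: cA.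
  apply: df; apply: ischain_insert => //; apply/allP=> x xc.
  apply: cmp; first by case/and3P: cA => _ _ /allP; apply.
  by apply: contraNneq ac => <-.
exists g => c cA; have [ac | ac] := boolP (a \in c); last first.
  rewrite da //; apply: eq_coboundary => s sc _.
  by rewrite /g (negPf (subseq_notin sc ac)).
have [c' [-> cA' ac' _]] := chain_through cA ac.
have srt : sorted lt c' by case/and3P: cA'.
rewrite coboundary_insert // (_ : coboundary (at_vertex a g) c' = 0).
  by rewrite subr0 /g (negPf ac') /at_vertex mulrA -expr2 sqrr_sign mul1r.
rewrite -[RHS](coboundary0 c'); apply: eq_coboundary => s _ _.
by rewrite /at_vertex /g mem_insert eqxx mulr0.
Qed.

(** A Mayer-Vietoris argument: the star of [w] is a cone glued to [A] along its link. After a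
    primitive on [A] is subtracted, the remainder vanishes on [A], so it is a cocycle on the link,
    whose primitive is spread over the simplices through [w]. *)
Lemma acyclic_add d A w : ~~ A w -> acyclic d.+1 A ->
  acyclic d (predI A (adjacent w)) -> acyclic d.+1 (predU1 w A).
Proof.
move=> Aw HA HL m f md df.
have sAU : {subset A <= predU1 w A} by move=> x Ax; apply/predU1P; right.
have [|g0 fg0] := HA m f md.
  by move=> c /(ischain_sub sAU)/df.
pose f1 c := f c - coboundary g0 c.
have f1A c : ischain A m c -> f1 c = 0.
  by move=> Ac; rewrite /f1 fg0 // subrr.
have df1 c : ischain (predU1 w A) m.+1 c -> coboundary f1 c = 0.
  by move=> Ac; rewrite coboundaryD coboundaryN coboundaryK subr0 df.
have sLA : {subset predI A (adjacent w) <= A} by move=> x /andP[].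
have insL n c : ischain (predI A (adjacent w)) n c ->
    ischain (predU1 w A) n.+1 (insert w c).
  move=> Lc; apply: ischain_insert; first by rewrite /= eqxx.
    by case/and3P: Lc => _ _; apply: sub_all => x /andP[].
  exact/(ischain_sub sAU)/(ischain_sub sLA).
have [h hP] : exists h, forall c,
    ischain (predI A (adjacent w)) m.-1 c -> m = m.-1.+1 ->
  at_vertex w f1 c = coboundary h c.
  have [m0 | m_gt0] := posnP m; first exists (fun=> 0).
    by move=> c _ def_m; rewrite def_m in m0.
  have [||h hP] := HL m.-1 (at_vertex w f1).
  - by rewrite -ltnS prednK.
  - rewrite prednK // => c Lc; have srt : sorted lt c by case/and3P: (Lc).
    rewrite -coboundary_at_vertex //; last exact/df1/insL.
    exact/f1A/(ischain_sub sLA).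
  by exists h => c Lc _; apply: hP.
(* The sign compensates the minus before the link term in [coboundary_insert]. *)
pose g1 c := if w \in c then extend_vertex w (fun s => - h s) c else 0.
exists (fun c => g0 c + g1 c) => c Uc; rewrite coboundaryD.
apply/eqP; rewrite -subr_eq0 opprD addrA subr_eq0 -/(f1 c); apply/eqP.
have [wc | wc] := boolP (w \in c); last first.
  have Ac : ischain A m c.
    case/and3P: Uc => sz srt /allP Uc; apply/and3P; split=> //.
    apply/allP=> x xc; have /predU1P[xw|//] := Uc x xc.
    by rewrite -xw xc in wc.
  rewrite f1A // -[LHS](coboundary0 c); apply: eq_coboundary => s sc _.
  by rewrite /g1 (negPf (subseq_notin sc wc)).
have [c' [-> + wc' def_m]] := chain_through Uc wc.
move=> /and3P[sz srt /allP Lc].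
have {Lc} Lc : ischain (predI A (adjacent w)) m.-1 c'.
  apply/and3P; split=> //; apply/allP=> x xc; have /andP[+ wx] := Lc x xc.
  case/predU1P=> [xw | Ax]; last exact/andP.
  by rewrite -xw xc in wc'.
rewrite coboundary_insert // {1}/g1 (negPf wc') sub0r.
rewrite (eq_coboundary (g := fun s => - h s)) => [|s sc _].
  rewrite coboundaryN opprK -hP // /at_vertex mulrA.
  by rewrite -expr2 sqrr_sign mul1r.
have sw : w \notin s := subseq_notin sc wc'.
apply: (at_vertex_extend (f := fun s => - h s)) => //; last first.
  by rewrite /g1 mem_insert eqxx.
exact: subseq_sorted sc srt.
Qed.

(** A primitive of [f] on the link extends [f] to a cocycle [f1] on [A] with [w] added; a primitive
    of [f1] restricts to one of [f]. *)
Lemma acyclic_del d A w : ~~ A w -> acyclic d (predU1 w A) ->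
  acyclic d (predI A (adjacent w)) -> acyclic d A.
Proof.
move=> Aw HU HL m f md df.
have sLA : {subset predI A (adjacent w) <= A} by move=> x /andP[].
have sAU : {subset A <= predU1 w A} by move=> x Ax; apply/predU1P; right.
have [|h hP] := HL m f md.
  by move=> c /(ischain_sub sLA)/df.
pose f1 c := if w \in c then extend_vertex w h c else f c.
have notA n c : ischain A n c -> w \notin c.
  by case/and3P=> _ _ /allP Ac; apply: contra Aw => /Ac.
have [|g fg] := HU m f1 md; last first.
  exists g => c Ac; rewrite -fg; first by rewrite /f1 (negPf (notA _ _ Ac)).
  exact: ischain_sub Ac.
move=> c Uc; have [wc | wc] := boolP (w \in c); last first.
  rewrite -[RHS](df c).
    apply: eq_coboundary => s sc _.
    by rewrite /f1 (negPf (subseq_notin sc wc)).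
  case/and3P: Uc => sz srt /allP Uc; apply/and3P; split=> //.
  apply/allP=> x xc; have /predU1P[xw|//] := Uc x xc.
  by rewrite -xw xc in wc.
have [c' [-> + wc' _]] := chain_through Uc wc.
move=> /and3P[sz srt /allP Lc].
have {Lc} Lc : ischain (predI A (adjacent w)) m c'.
  apply/and3P; split=> //; apply/allP=> x xc; have /andP[+ wx] := Lc x xc.
  case/predU1P=> [xw | Ax]; last exact/andP.
  by rewrite -xw xc in wc'.
rewrite coboundary_insert // {1}/f1 (negPf wc') hP //.
rewrite (eq_coboundary (g := h)) ?subrr ?mulr0 // => s sc _.
have sw : w \notin s := subseq_notin sc wc'.
apply: at_vertex_extend => //; last by rewrite /f1 mem_insert eqxx.
exact: subseq_sorted sc srt.
Qed.

End Cochains.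

(** * Certificates of acyclicity and joins *)

Section Constructible.

Variables (T : eqType) (e : rel T).
Hypotheses (e_sym : symmetric e) (e_irr : irreflexive e).

Implicit Types (A B Y Z : pred T) (s : seq T) (w : T).

(* A combinatorial certificate that the clique complex of [e] on [A] has no
   reduced cohomology in degrees below [d - 1]. *)
Inductive constructible : nat -> pred T -> Prop :=
| Constr0 A : constructible 0 A
| ConstrCone d A a : A a -> (forall x, A x -> x != a -> e a x) ->
    constructible d A
| ConstrAdd d A w : ~~ A w -> constructible d.+1 A ->
    constructible d (predI A (e w)) -> constructible d.+1 (predU1 w A)
| ConstrExt d A B : A =1 B -> constructible d A -> constructible d B.

Lemma constructible_add_seq d A s :
    uniq s -> {in s, forall w, ~~ A w} -> constructible d.+1 A ->
    (forall s1 w, prefix (rcons s1 w) s ->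
       constructible d (predI (predU [in s1] A) (e w))) ->
  constructible d.+1 (predU [in s] A).
Proof.
elim/last_ind: s => [|s w IHs] Us sA cA cs.
  by apply: ConstrExt cA.
move: Us; rewrite rcons_uniq => /andP[ws Us].
apply: (@ConstrExt _ (predU1 w (predU [in s] A))) => [x|].
  by rewrite /= mem_rcons in_cons orbA.
apply: ConstrAdd; last by apply: cs; apply: prefix_refl.
  by rewrite /= negb_or ws sA // mem_rcons mem_head.
apply: IHs => // [x xs|s1 x s1x].
  by rewrite sA // mem_rcons in_cons xs orbT.
by apply: cs; apply: prefix_trans s1x _; apply: prefix_rcons.
Qed.

(** The base case of the join: a cone apex or added vertex of [Y] keeps its role when any [Z]
    adjacent to all of [Y] is joined, its link growing by all of [Z]. *)
Lemma constructible_join0 b Y : constructible b Y ->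
  forall Z, (forall z y, Z z -> Y y -> e z y) -> constructible b (predU Z Y).
Proof.
elim=> {b Y} [Y|b Y a Ya aY|b Y w Yw _ IH1 _ IH2|b Y Y' YY' _ IH] Z ZY.
- exact: Constr0.
- apply: (@ConstrCone _ _ a) => [|x /orP[Zx | Yx] xa].
  + by rewrite /= Ya orbT.
  + by rewrite e_sym ZY.
  + exact: aY.
- have wZ z : Z z -> e w z by rewrite e_sym => Zz; apply: ZY; rewrite //= eqxx.
  apply: (@ConstrExt _ (predU1 w (predU Z Y))) => [x|].
    by rewrite /= orbCA.
  apply: ConstrAdd.
  + by rewrite /= negb_or Yw andbT; apply/negP=> /wZ; rewrite e_irr.
  + by apply: IH1 => z y Zz Yy; apply: ZY => //; apply/predU1P; right.
  apply: (@ConstrExt _ (predU Z (predI Y (e w)))) => [x|].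
    rewrite /= andb_orl; congr (_ || _).
    by case Zx: (Z x); rewrite //= wZ.
  by apply: IH2 => z y Zz /andP[Yy _]; apply: ZY => //; apply/predU1P; right.
apply: (@ConstrExt _ (predU Z Y)) => [x|]; first by rewrite /= YY'.
by apply: IH => z y Zz Yy; apply: ZY; rewrite // -YY'.
Qed.

(** Induction on the certificate of [Z]: a cone stays a cone, and the link of a new vertex of [Z] is
    the join of its link in [Z] with [Y]. *)
Lemma constructible_join d b Z Y :
    constructible d Z -> constructible b Y ->
  (forall z y, Z z -> Y y -> e z y) -> constructible (d + b)%N (predU Z Y).
Proof.
move=> cZ cY; elim: cZ => {d Z}
  [Z|d Z a Za aZ|d Z w Zw _ IH1 _ IH2|d Z Z' ZZ' _ IH] ZY.
- exact: constructible_join0.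
- apply: (@ConstrCone _ _ a) => [|x /orP[Zx | Yx] xa]; first by rewrite /= Za.
    exact: aZ.
  exact: ZY.
- have wY y : Y y -> e w y by apply: ZY; rewrite /= eqxx.
  apply: (@ConstrExt _ (predU1 w (predU Z Y))) => [x|].
    by rewrite /= orbA.
  rewrite addSn; apply: ConstrAdd.
  + by rewrite /= negb_or Zw /=; apply/negP=> /wY; rewrite e_irr.
  + by apply: IH1 => z y Zz Yy; apply: ZY => //; apply/predU1P; right.
  apply: (@ConstrExt _ (predU (predI Z (e w)) Y)) => [x|].
    rewrite /= andb_orl; congr (_ || _).
    by case Yx: (Y x); rewrite //= wY.
  by apply: IH2 => z y /andP[Zz _] Yy; apply: ZY => //; apply/predU1P; right.
apply: (@ConstrExt _ (predU Z Y)) => [x|]; first by rewrite /= ZZ'.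
by apply: IH => z y Zz Yy; apply: ZY; rewrite // -ZZ'.
Qed.

(** The predicate in the conclusion describes the image of [A] under [f], on which [g] is the
    inverse. *)
Lemma constructible_embed (f g : T -> T) d A :
    cancel f g -> (forall x y, e (f x) (f y) = e x y) ->
  constructible d A -> constructible d [pred y | (f (g y) == y) && A (g y)].
Proof.
move=> fK fe; elim=> {d A} [A|d A a Aa aA|d A w Aw _ IH1 _ IH2|d A B AB _ IH].
- exact: Constr0.
- apply: (@ConstrCone _ _ (f a)) => [|y /= /andP[/eqP <- Ay] nya].
    by rewrite /= fK eqxx.
  rewrite fK in Ay; rewrite fe aA //.
  by apply: contraNneq nya => ->.
- apply: (@ConstrExt _ (predU1 (f w) [pred y | (f (g y) == y) && A (g y)])).
    move=> y /=; rewrite andb_orr; congr (_ || _).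
    by apply/eqP/andP=> [->|[/eqP fgy /eqP <-]] //; rewrite fK !eqxx.
  apply: ConstrAdd => //; first by rewrite /= fK (negPf Aw) andbF.
  apply: ConstrExt IH2 => y /=; rewrite -andbA.
  case: eqP => //= fgy; congr (_ && _).
  by rewrite -[in RHS]fgy fe.
apply: ConstrExt IH => y /=; by rewrite AB.
Qed.

End Constructible.

Section OrderConstructible.

Variables (T : eqType) (lt : rel T).
Hypotheses (lt_trans : transitive lt) (lt_irr : irreflexive lt).

Local Notation adjacent := (adjacent lt).

Lemma adjacent_sym : symmetric adjacent.
Proof. by move=> x y; rewrite /adjacent orbC. Qed.

Lemma adjacent_irr : irreflexive adjacent.
Proof. by move=> x; rewrite /adjacent lt_irr. Qed.

Lemma constructible_acyclic (R : nzRingType) d A :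
  constructible adjacent d A -> acyclic R lt d A.
Proof.
elim=> {d A} [A m //|d A a Aa aA|d A w Aw _ IH1 _ IH2|d A B AB _ IH].
- exact: acyclic_cone aA.
- exact: acyclic_add.
exact: acyclic_ext IH.
Qed.

(** Members of [s] are pairwise incomparable, so deleting some does not alter the links of the
    others. *)
Lemma acyclic_del_seq (R : nzRingType) d A (s : seq T) :
    uniq s -> {in s, forall w, ~~ A w} ->
    {in s &, forall w w', ~~ adjacent w w'} ->
    {in s, forall w, acyclic R lt d (predI A (adjacent w))} ->
  acyclic R lt d (predU [in s] A) -> acyclic R lt d A.
Proof.
elim: s => [|w s IHs] /=.
  by move=> _ _ _ _; apply: acyclic_ext.
case/andP=> ws Us sA ss cs cU; apply: IHs => //.
- by move=> x xs; apply: sA; rewrite in_cons xs orbT.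
- by move=> x y xs ys; apply: ss; rewrite in_cons (xs, ys) orbT.
- by move=> x xs; apply: cs; rewrite in_cons xs orbT.
apply: (@acyclic_del R T lt lt_trans lt_irr d (predU [in s] A) w).
- by rewrite /= negb_or ws sA ?mem_head.
- by apply: acyclic_ext cU => x; rewrite /= in_cons orbA.
apply: acyclic_ext (cs w (mem_head _ _)) => x /=.
case xs: (x \in s) => //=; rewrite andbC.
by rewrite (negPf (ss w x _ _)) // ?mem_head // in_cons xs orbT.
Qed.

(* Adding the elements outside [C] by increasing rank, the link of each [x] is a
   cone with apex [g x]. *)
Lemma constructible_closure d (C A : pred T) (g : T -> T) (rk : T -> nat)
    (s : seq T) :
    {homo rk : x y / lt x y >-> (x < y)%N} ->
    subpred C A -> (forall x, A x -> ~~ C x -> x \in s) ->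
    (forall x, A x -> ~~ C x -> C (g x) /\ lt x (g x)) ->
    (forall x y, A x -> ~~ C x -> C y -> lt x y -> (y == g x) || lt (g x) y) ->
  constructible adjacent d C -> constructible adjacent d A.
Proof.
move=> rk_lt CA As gC g_le cC; case: d cC => [|d] cC; first exact: Constr0.
pose s1 := sort (relpre rk leq) (undup [seq x <- s | A x && ~~ C x]).
have s1P x : (x \in s1) = A x && ~~ C x.
  rewrite mem_sort mem_undup mem_filter andb_idr // => /andP[].
  exact: As.
apply: (@ConstrExt _ _ _ (predU [in s1] C)) => [x|].
  rewrite /= s1P; case Cx: (C x); last by rewrite orbF andbT.
  by rewrite orbT CA.
apply: constructible_add_seq => //; first by rewrite sort_uniq undup_uniq.
  by move=> x; rewrite s1P => /andP[].
move=> s2 w /prefixP[s3 def_s1].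
have : w \in s1 by rewrite def_s1 mem_cat mem_rcons mem_head.
rewrite s1P => /andP[Aw Cw]; have [Cgw wgw] := gC w Aw Cw.
have s2w x : x \in s2 -> (rk x <= rk w)%N.
  move=> xs2; have : sorted (relpre rk leq) s1.
    by apply: sort_sorted => y z /=; apply: leq_total.
  rewrite sorted_pairwise; last by move=> y x' z /=; apply: leq_trans.
  rewrite def_s1 pairwise_cat pairwise_rcons => /and3P[_ /andP[/allP + _] _].
  exact.
apply: (@ConstrCone _ _ _ _ (g w)) => [|x /andP[Ux /orP[wx|xw]] ne_x].
- by rewrite /= Cgw orbT /adjacent wgw.
- case/orP: Ux => [/s2w|Cx]; first by rewrite leqNgt rk_lt.
  by have := g_le _ _ Aw Cw Cx wx; rewrite (negPf ne_x) /adjacent /= => ->.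
by rewrite /adjacent (lt_trans xw wgw) orbT.
Qed.

End OrderConstructible.

(** * The subword order *)

Section SubwordOrder.

Variable X : finType.

Implicit Types (u v w x y : seq X) (a b : X).

Definition ltw u v := subseq u v && (u != v).

Lemma ltw_size u v : ltw u v -> (size u < size v)%N.
Proof.
by case/andP=> /size_subseq_leqif/ltn_leqif ->.
Qed.

Lemma ltwE u v : ltw u v = subseq u v && (size u < size v)%N.
Proof.
apply/idP/andP=> [uv | [uv szuv]]; first by rewrite ltw_size //; case/andP: uv.
by rewrite /ltw uv; apply: contraTneq szuv => ->; rewrite ltnn.
Qed.

Lemma ltw_trans : transitive ltw.
Proof.
move=> v u w; rewrite !ltwE => /andP[uv suv] /andP[vw svw].
by rewrite (subseq_trans uv vw) (ltn_trans suv svw).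
Qed.

Lemma ltw_irr : irreflexive ltw.
Proof. by move=> u; rewrite /ltw eqxx andbF. Qed.

Lemma ltw_nil u : ltw [::] u = (0 < size u)%N.
Proof. by rewrite ltwE sub0seq. Qed.

Definition chop u := take (size u).-1 u.

Lemma chop_rcons u a : chop (rcons u a) = u.
Proof. by rewrite /chop size_rcons -cats1 take_size_cat. Qed.

Definition ends a u := rcons (chop u) a == u.

Lemma endsP a u : reflect (exists v, u = rcons v a) (ends a u).
Proof.
apply: (iffP eqP) => [<- | [v ->]]; first by exists (chop u).
by rewrite chop_rcons.
Qed.

Lemma ends_rcons a u : ends a (rcons u a).
Proof. by apply/endsP; exists u. Qed.

Lemma ends_inj a b u : ends a u -> ends b u -> a = b.
Proof. by case/endsP=> v -> /endsP[w /rcons_inj[]]. Qed.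

Lemma subseq_rcons2 a u v : subseq (rcons u a) (rcons v a) = subseq u v.
Proof. by rewrite -subseq_rev !rev_rcons /= eqxx subseq_rev. Qed.

Lemma ltw_rcons2 a u v : ltw (rcons u a) (rcons v a) = ltw u v.
Proof. by rewrite !ltwE subseq_rcons2 !size_rcons. Qed.

Lemma subseq_rconsN a u v : ~~ ends a u -> subseq u (rcons v a) = subseq u v.
Proof.
case/lastP: u => [|u b] nu; first by rewrite !sub0seq.
rewrite -subseq_rev !rev_rcons /= (_ : (b == a) = false).
  by rewrite -rev_rcons subseq_rev.
by apply: contraNF nu => /eqP->; apply: ends_rcons.
Qed.

Lemma ltw_rcons a u : ltw u (rcons u a).
Proof. by rewrite ltwE subseq_rcons size_rcons /=. Qed.

(** This is the closure property required by [constructible_closure]; it also makes [rcons u a] the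
    apex of a cone. *)
Lemma rcons_least a u v : ~~ ends a u -> ends a v -> ltw u v ->
  (v == rcons u a) || ltw (rcons u a) v.
Proof.
move=> ua /endsP[v' ->]; rewrite {1}/ltw subseq_rconsN // => /andP[uv' _].
by rewrite ltw_rcons2 /ltw uv' /= (inj_eq (@rcons_injl _ a)) eq_sym orbN.
Qed.

Definition words_upto k := [seq bseqval t | t <- enum {: k.-bseq X}].

Lemma mem_words_upto k u : (u \in words_upto k) = (size u <= k)%N.
Proof.
apply/mapP/idP=> [[v _ ->]|uk]; first exact: size_bseq.
by exists (Bseq uk); rewrite ?mem_enum.
Qed.

Local Notation comp := (adjacent ltw).

Definition interval u w := [pred v | ltw u v && ltw v w].

(** The bound is the number of lengths strictly between those of [u] and [w], so all cohomology
    below the top dimension is excluded. *)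
Lemma interval_constructible u w : ltw u w ->
  constructible comp (size w - size u).-1 (interval u w).
Proof.
elim/last_ind: w u => [|w a IHw] u uw; first by have := ltw_size uw.
pose C := [pred v | interval u (rcons w a) v && ends a v].
rewrite size_rcons; have cC : constructible comp ((size w).+1 - size u).-1 C.
  (* If [u] ends in [a], removing the final [a] identifies [C] with a shorter interval; otherwise
     [rcons u a] is an apex unless [u = w], when the claimed degree is 0. *)
  have [/endsP[u' def_u] | ua] := boolP (ends a u).
    rewrite def_u ltw_rcons2 in uw; have := IHw _ uw.
    move/(constructible_embed (fun v => chop_rcons v a)).
    rewrite def_u size_rcons subSS => /(_ _)cw.
    apply: ConstrExt (cw _) => [v|x y].
      rewrite /= /ends andbC; case: eqP => [def_v|]; rewrite ?andbF //.
      rewrite !andbT -{3 4}def_v. by rewrite def_u !ltw_rcons2.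
    by rewrite /adjacent !ltw_rcons2.
  have uw' : subseq u w by rewrite -(subseq_rconsN _ ua); case/andP: uw.
  have [eq_uw | ne_uw] := eqVneq u w.
    by rewrite eq_uw subSnn; apply: Constr0.
  apply: (@ConstrCone _ _ _ _ (rcons u a)) => [|v /andP[/andP[uv _] va] nv].
    by rewrite /= ends_rcons ltw_rcons ltw_rcons2 /ltw uw' ne_uw.
  by have := rcons_least ua va uv; rewrite (negPf nv) /adjacent /= => ->.
(* The closure would send [w] to the excluded endpoint [rcons w a], so [w] is set aside when it does
   not end in [a]. *)
pose A := [pred v | interval u (rcons w a) v && (ends a w || (v != w))].
have cA : constructible comp ((size w).+1 - size u).-1 A.
  apply: (constructible_closure ltw_trans (g := rcons^~ a) (rk := size)
    (s := words_upto (size w).+1)) cC.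
  - exact: ltw_size.
  - move=> v /= /andP[Iv va] /=; rewrite Iv; case wa: (ends a w) => //=.
    by apply: contraTneq va => ->; rewrite wa.
  - move=> v /= /andP[/andP[_ /ltw_size]]; rewrite size_rcons mem_words_upto.
    by move/ltnW.
  - move=> v /= /andP[Iv nv]; rewrite Iv /= => va.
    rewrite ltw_rcons; split=> //.
    case/andP: Iv => uv; rewrite ends_rcons (ltw_trans uv (ltw_rcons a v)) /=.
    rewrite {1}/ltw subseq_rconsN // ltw_rcons2 /ltw => /andP[-> _] /=.
    by rewrite andbT; case/orP: nv => //; apply: contraTneq => <-.
  - move=> v y /= /andP[Iv _]; rewrite Iv /= => va /andP[_ ya].
    exact: rcons_least.
have [wA | wA] := boolP (~~ ends a w && ltw u w); last first.
  apply: ConstrExt cA => v /=; apply: andb_idr => /andP[uv vw].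
  apply: contraNT wA; rewrite negb_or negbK => /andP[-> /eqP <-] /=.
  exact: uv.
case/andP: wA => wa ltuw.
have -> : ((size w).+1 - size u).-1 = (size w - size u).-1.+1.
  by rewrite subSn ?(ltnW (ltw_size _)) // prednK // subn_gt0 ltw_size.
apply: (@ConstrExt _ _ _ (predU1 w A)) => [v|].
  rewrite /= (negPf wa) /=; have [->|_] := eqVneq v w; last by rewrite andbT.
  by rewrite ltuw ltw_rcons.
apply: ConstrAdd.
- by rewrite /= (negPf wa) eqxx andbF.
- move: cA; rewrite subSn ?(ltnW (ltw_size _)) // prednK // subn_gt0.
  exact: ltw_size.
(* A word strictly above [w] is at least as long as [rcons w a], so the link of [w] is the interval
   below it. *)
apply: ConstrExt (IHw _ ltuw) => v /=; rewrite (negPf wa) /=.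
apply/andP/andP=> [[uv vw] | [/andP[/andP[uv vwa] nv]]].
  rewrite uv (ltw_trans vw (ltw_rcons _ _)) /adjacent vw orbT /=.
  by split=> //; case/andP: vw.
case/orP=> // /ltw_size wv; have := ltw_size vwa.
by rewrite size_rcons ltnS leqNgt wv.
Qed.

Definition upper x k := [pred v | ltw x v && (size v <= k)%N].

(** The words ending in a letter [a] that [x] does not end in form a cone with apex [rcons x a].
    Closure under appending [a] adds the other words shorter than [k]; those of length [k] come
    last, with intervals as links. *)
Lemma upper_constructible x k : (1 < #|X|)%N -> (size x <= k)%N ->
  constructible comp (k - size x) (upper x k).
Proof.
case/card_gt1P=> p [q [_ _ ne_pq]]; rewrite leq_eqVlt => /predU1P[->|xk].
  by rewrite subnn; apply: Constr0.
have [a xa] : exists a, ~~ ends a x.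
  have [xp | xp] := boolP (ends p x); last by exists p.
  by exists q; apply: contra ne_pq => /(ends_inj xp) ->.
pose C := [pred v | upper x k v && ends a v].
have cC d : constructible comp d C.
  apply: (@ConstrCone _ _ _ _ (rcons x a)) => [|v /andP[/andP[xv _] va] nv].
    by rewrite /= ltw_rcons ends_rcons size_rcons xk.
  by have := rcons_least xa va xv; rewrite (negPf nv) /adjacent /= => ->.
pose B := [pred v | upper x k v && (ends a v || (size v < k)%N)].
have cB d : constructible comp d B.
  apply: (constructible_closure ltw_trans (g := rcons^~ a) (rk := size)
    (s := words_upto k)) (cC d).
  - exact: ltw_size.
  - by move=> v /= /andP[-> ->].
  - by move=> v /= /andP[/andP[_ vk] _] _; rewrite mem_words_upto.
  - move=> v /= /andP[Uv vk]; rewrite Uv /= => va.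
    rewrite ltw_rcons; split=> //.
    rewrite (negPf va) /= in vk; case/andP: Uv => xv _.
    by rewrite ends_rcons (ltw_trans xv (ltw_rcons a v)) size_rcons vk.
  - move=> v y /= /andP[Uv _]; rewrite Uv /= => va /andP[_ ya].
    exact: rcons_least.
pose s := undup [seq v <- words_upto k | upper x k v && ~~ B v].
have sP v : (v \in s) = upper x k v && ~~ B v.
  rewrite mem_undup mem_filter andb_idr // => /andP[/andP[_ vk] _].
  by rewrite mem_words_upto.
apply: (@ConstrExt _ _ _ (predU [in s] B)) => [v|].
  rewrite [LHS]/= [v \in s]sP /=.
  by case: (ltw x v); case: (size v <= k)%N; rewrite //= orNb.
have s_top v : v \in s -> ltw x v /\ size v = k.
  rewrite sP => /= /andP[/andP[xv vk]]; rewrite xv vk /= negb_or -leqNgt.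
  by case/andP=> _ kv; split=> //; apply/eqP; rewrite eqn_leq vk.
have def_k : (k - size x = (k - size x).-1.+1)%N by rewrite prednK // subn_gt0.
rewrite def_k; apply: constructible_add_seq; rewrite ?undup_uniq //.
  by move=> v; rewrite sP => /andP[].
move=> s1 w s1w; have s1s v : v \in rcons s1 w -> v \in s.
  by case/prefixP: s1w => s2 ->; rewrite mem_cat => ->.
have [xw wk] : ltw x w /\ size w = k.
  by apply/s_top/s1s; rewrite mem_rcons mem_head.
have := interval_constructible xw; rewrite wk; apply: ConstrExt => v /=.
apply/andP/andP=> [[xv vw] | [Uv /orP[wv | vw]]].
- rewrite xv /adjacent vw orbT /=; split=> //.
  by rewrite -wk (ltnW (ltw_size vw)) (ltw_size vw) !orbT.
- have := ltw_size wv; rewrite wk ltnNge => /negP[].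
  case/orP: Uv => [vs|/andP[/andP[]] //].
  have [|_ ->] := s_top v => //; apply: s1s.
  by rewrite mem_rcons in_cons vs orbT.
split=> //; case/orP: Uv => [vs|/andP[/andP[]] //].
by have [] := s_top v => //; apply: s1s; rewrite mem_rcons in_cons vs orbT.
Qed.

(** The words of length [r] form an antichain. The link of one is the join of the words below it and
    those above it, and the degrees [r.-1] and [k - r] of the two factors add up to [k.-1]. *)
Lemma rank_deleted_acyclic (R : nzRingType) k r :
    (1 < #|X|)%N -> (0 < r <= k)%N ->
  acyclic R ltw k.-1 [pred v | (0 < size v <= k)%N && (size v != r)].
Proof.
move=> gt1 /andP[r_gt0 rk]; set Q := [pred v | _].
pose s := undup [seq v <- words_upto k | size v == r].
have sP v : (v \in s) = (size v == r).
  rewrite mem_undup mem_filter andb_idr // => /eqP vr.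
  by rewrite mem_words_upto vr.
apply: (acyclic_del_seq ltw_trans ltw_irr (s := s)).
- exact: undup_uniq.
- by move=> v; rewrite sP /= => /eqP->; rewrite eqxx andbF.
- move=> v w; rewrite !sP => /eqP vr /eqP wr.
  by apply/norP; rewrite !ltwE vr wr ltnn !andbF.
- move=> w; rewrite sP => /eqP wr; apply: constructible_acyclic.
  + exact: ltw_trans.
  + exact: ltw_irr.
  have -> : k.-1 = ((size w - size (@nil X)).-1 + (k - size w))%N.
    by rewrite wr subn0 -{1}(subnKC rk) -{1}(prednK r_gt0).
  apply: (@ConstrExt _ _ _ (predU (interval [::] w) (upper w k))) => [v|].
    rewrite /= /adjacent !ltw_nil.
    have [vw | vw] := boolP (ltw v w).
      have := ltw_size vw; rewrite wr => vr.
      rewrite orbT !andbT (leq_trans (ltnW vr) rk) (ltn_eqF vr) !andbT.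
      rewrite (negPf (_ : ~~ ltw w v)) ?orbF // ltwE wr (ltnNge r).
      by rewrite (ltnW vr) andbF.
    rewrite andbF orbF /=.
    have [wv|_] := boolP (ltw w v); last by rewrite andbF.
    have := ltw_size wv; rewrite wr => vr.
    by rewrite (gtn_eqF vr) (leq_ltn_trans _ vr) ?andbT.
  apply: (constructible_join (@adjacent_sym _ _) (adjacent_irr ltw_irr)).
  + by apply: interval_constructible; rewrite ltw_nil wr.
  + by apply: upper_constructible; rewrite ?wr.
  move=> z y /andP[_ zw] /andP[wy _].
  by rewrite /adjacent (ltw_trans zw wy).
apply: (@acyclic_leq _ _ _ _ k); first exact: leq_pred.
apply: (@acyclic_ext _ _ _ _ (upper [::] k)) => [v|].
  rewrite /= [v \in s]sP ltw_nil; have [->|_] := eqVneq (size v) r.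
    by rewrite r_gt0 rk.
  by rewrite andbT.
apply: constructible_acyclic; [exact: ltw_trans | exact: ltw_irr |].
by have := upper_constructible (x := [::]) gt1 (leq0n k); rewrite subn0.
Qed.

End SubwordOrder.

(** * From cochains to boundary matrices *)

Lemma coboundaryE (R : nzRingType) (disp : Order.disp_t)
    (P : finPOrderType disp) (f : seq P -> R) (c : seq P) :
  coboundary f c = \sum_(l < size c) (-1) ^+ l * f (face l c).
Proof.
elim: c f => [|x c IHc] f /=; first by rewrite big_ord0.
rewrite big_ord_recl /= mul1r {1}/face /= drop0 IHc -sumrN; congr (_ + _).
by apply: eq_bigr => l _; rewrite exprS mulN1r mulNr.
Qed.

Lemma coboundary_map (R : nzRingType) (T T' : eqType) (h : T -> T')
    (f : seq T' -> R) c :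
  coboundary f (map h c) = coboundary (fun s => f (map h s)) c.
Proof. by elim: c f => //= x c IHc f; rewrite IHc. Qed.

(** Exactness at the middle term is an equality of ranks, and transposition preserves ranks; this
    turns vanishing cohomology into vanishing homology. *)
Lemma kermx_sub_of_tr (F : fieldType) m n p (A : 'M[F]_(m, n)) (B : 'M_(n, p)) :
    A *m B = 0 ->
    (forall v : 'rV_n, v *m A^T = 0 -> exists u : 'rV_p, v = u *m B^T) ->
  (kermx B <= A)%MS.
Proof.
move=> AB0 exAB; have sAB : (A <= kermx B)%MS by apply/sub_kermxP.
rewrite -(mxrank_leqif_sup sAB) eqn_leq mxrankS //= mxrank_ker leq_subLR.
have : (kermx A^T <= B^T)%MS.
  apply/rV_subP=> v /sub_kermxP/exAB[u ->]; exact: submxMl.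
by move/mxrankS; rewrite mxrank_ker !mxrank_tr leq_subLR addnC.
Qed.

Section BoundaryExact.

Variables (F : fieldType) (disp : Order.disp_t) (P : finPOrderType disp).

Lemma sum_incidence m (c : chain P m) (f : seq P -> F) :
  \sum_(c' : chain P m.-1) f (val c') * incidence F c c' =
  coboundary f (val c).
Proof.
rewrite coboundaryE.
under eq_bigr => c' _ do rewrite mulr_sumr big_mkcond.
rewrite exchange_big /= [in RHS]size_tuple; apply: eq_bigr => l _.
have lc : (l < size (val c))%N by rewrite size_tuple.
have fs : size (face l (val c)) == m.-1 by rewrite size_face // size_tuple.
have fS : sorted <%O (Tuple fs) by apply: face_sorted; apply: (valP c).
pose c1 : chain P m.-1 := exist _ (Tuple fs) fS.
rewrite (bigD1 c1) //= eqxx big1 ?addr0; first by rewrite mulrC.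
move=> c' ne_c'; case: eqP => // Ec'; case/eqP: ne_c'.
by do 2![apply: val_inj].
Qed.

Variables (T : eqType) (lt : rel T) (A : pred T) (h : P -> T).
Hypotheses (h_inj : injective h) (h_lt : {mono h : x y / (x < y)%O >-> lt x y}).
Hypothesis A_codom : forall t, A t -> exists x, t = h x.
Hypothesis h_A : forall x, A (h x).

Lemma acyclic_boundary_exact d m : acyclic F lt d A -> (m < d)%N ->
  (kermx (boundary F P m) <= boundary F P m.+1)%MS.
Proof.
move=> acA md; apply: kermx_sub_of_tr; first exact: boundary_boundary.
move=> v dv; pose psi t := [pick x | h x == t].
have psiK : pcancel h psi.
  move=> x; rewrite /psi; case: pickP => [y /eqP/h_inj -> // | /(_ x)].
  by rewrite eqxx.
have psisK c : pmap psi (map h c) = c by rewrite (map_pK psiK).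
(* [fP] extends [v] to all lists, with value 0 on those that are not chains of [m] elements. *)
pose fP (c : seq P) : F :=
  \sum_(c' : chain P m | val (val c') == c) v 0 (enum_rank c').
have fPE (c : chain P m) : fP (val c) = v 0 (enum_rank c).
  rewrite /fP (bigD1 c) //= big1 ?addr0 // => c' /andP[/eqP Ec'].
  by case/eqP; do 2![apply: val_inj].
have chainP j t : ischain lt A j t ->
    exists c : chain P j, t = map h (val c).
  case/and3P=> st srt /allP At; have [s def_t] : exists s, t = map h s.
    elim: t At {st srt} => [|x t IHt] At; first by exists [::].
    have [|s ->] := IHt.
      by move=> y yt; apply: At; rewrite in_cons yt orbT.
    by have [y ->] := A_codom (At x (mem_head _ _)); exists (y :: s).
  move: st srt; rewrite def_t size_map (mono_sorted h_lt) => ss srt.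
  by exists (exist _ (Tuple ss) srt).
have [c /chainP[{}c ->] | g fg] := acA m (fun t => fP (pmap psi t)) md.
  rewrite coboundary_map (eq_coboundary (g := fP)) => [|s _ _]; last first.
    by rewrite psisK.
  rewrite -sum_incidence; move/rowP/(_ (enum_rank c)): dv.
  rewrite !mxE => dv; rewrite -[RHS]dv (reindex enum_rank) /=; last first.
    exact/onW_bij/enum_rank_bij.
  by apply: eq_bigr => c' _; rewrite fPE !mxE !enum_rankK.
exists (\row_(i < #|{: chain P m.-1}|) g (map h (val (enum_val i)))).
apply/rowP=> i.
rewrite -(enum_valK i); move: (enum_val i) => {i} c.
have := fg (map h (val c)).
rewrite psisK fPE coboundary_map -sum_incidence => ->.
  rewrite !mxE (reindex enum_rank) /=; last exact/onW_bij/enum_rank_bij.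
  by apply: eq_bigr => c' _; rewrite !mxE !enum_rankK.
apply/and3P; split; first by rewrite size_map size_tuple.
  by rewrite (mono_sorted h_lt); apply: (valP c).
by apply/allP=> _ /mapP[x _ ->].
Qed.

End BoundaryExact.

Section Letters.

Variables n k r : nat.
Let S := [pred i : nat | (1 <= i <= k)%N && (i != r)].
Local Notation P := (words n k S).

Definition letters (w : P) : seq 'I_n := val (val w).

Lemma letters_inj : injective letters.
Proof. by move=> u v /val_inj/val_inj. Qed.

Lemma ltw_letters (u v : P) : ltw (letters u) (letters v) = (u < v)%O.
Proof. by rewrite lt_neqAle andbC /ltw (inj_eq letters_inj). Qed.

Lemma letters_codom t : size t \in S -> exists w, t = letters w.
Proof.
move=> St; have tk : (size t <= k)%N by case/andP: St => /andP[].
have St' : size (Bseq tk) \in S by [].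
by exists (exist _ (Bseq tk) St').
Qed.

Lemma size_letters w : size (letters w) \in S.
Proof. exact: (valP w). Qed.

End Letters.

Arguments letters {n k r} w.
Arguments letters_inj {n k r}.

Lemma words_boundary_exact (F : fieldType) n k r m
    (S := [pred i : nat | (1 <= i <= k)%N && (i != r)]) :
    (1 < n)%N -> (0 < r <= k)%N -> (m < k.-1)%N ->
  (kermx (boundary F (words n k S) m) <= boundary F (words n k S) m.+1)%MS.
Proof.
move=> n_gt1 rk mk; have ac := @rank_deleted_acyclic 'I_n F k r.
rewrite card_ord in ac.
apply: (acyclic_boundary_exact _ _ _ _ (ac n_gt1 rk) mk).
- exact: letters_inj.
- exact: ltw_letters.
- exact: letters_codom.
exact: size_letters.
Qed.

(** * The trace of the Specht module of shape (n - 1, 1) *)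

Section PermRepr.

Variables (F : fieldType) (gT : finGroupType) (T : finType).
Variable to : {action gT &-> T}.

Lemma mxtrace_perm_repr g :
  \tr (perm_repr F to g) = #|[set x | to x g == x]|%:R.
Proof.
rewrite /mxtrace (reindex enum_rank) /=; last exact/onW_bij/enum_rank_bij.
under eq_bigr => x _ do rewrite mxE enum_rankK.
rewrite -sum1_card natr_sum [RHS]big_mkcond; apply: eq_bigr => x _.
by rewrite inE; case: eqP.
Qed.

Lemma delta_perm_repr x g :
  delta_mx 0 (enum_rank x) *m perm_repr F to g =
    delta_mx 0 (enum_rank (to x g)) :> 'rV_#|T|.
Proof.
apply/rowP=> j; rewrite -rowE !mxE enum_rankK eqxx /=.
by rewrite -(inj_eq enum_rank_inj) enum_valK eq_sym.
Qed.

End PermRepr.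

Section StandardSpecht.

Variables (F : fieldType) (m : nat).
Local Notation n := m.+2.
Local Notation la := [:: m.+1; 1%N].
Local Notation rT := (tabloid_repr F n la).
Local Notation rN := (perm_repr F 'P%act : mx_representation F [set: 'S_n] _).

(** For this shape a tabloid is determined by the single entry of its second row. *)
Definition singleton_tabloid (i : 'I_n) : (size la).-tuple {set 'I_n} :=
  [tuple of [:: [set~ i]; [set i]]].

Lemma singleton_tabloid_inj : injective singleton_tabloid.
Proof. by move=> i j /(congr1 val)[_ /set1_inj]. Qed.

Lemma act_singleton_tabloid i s :
  ('P^* * size la)%act (singleton_tabloid i) s = singleton_tabloid (s i).
Proof.
apply: val_inj; rewrite /= /setact /=; congr [:: _; _].
  apply/setP=> j; rewrite -[j](permKV s) mem_imset; last exact: perm_inj.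
  by rewrite !inE (inj_eq perm_inj).
by rewrite imset_set1.
Qed.

Lemma reshape_index_la (i : 'I_n) : reshape_index la i = (i == ord_max) :> nat.
Proof.
rewrite /reshape_index /= subSS subn_eq0 -val_eqE /=.
have := ltn_ord i; rewrite ltnS leq_eqVlt => /predU1P[-> | im].
  by rewrite ltnn eqxx subSnn subnn.
by rewrite -ltnS im (ltn_eqF im).
Qed.

Lemma tabloid0E : tabloid0 n la = singleton_tabloid ord_max.
Proof.
apply: eq_from_tnth => r; rewrite tnth_mktuple; apply/setP=> i.
rewrite inE reshape_index_la.
case: r => -[|[|r]] //= r2; rewrite (tnth_nth set0) /= !inE.
  by case: (i == ord_max).
by case: (i == ord_max).
Qed.

Lemma reshape_offset_la (i : 'I_n) :
  reshape_offset la i = if i == ord_max then 0%N else i.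
Proof.
rewrite /reshape_offset reshape_index_la; case: eqP => [->|] /=.
  by rewrite addn0 subnn.
by rewrite subn0.
Qed.

(** The first column, with cells [ord0] and [ord_max], is the only one with more than one cell. *)
Lemma column_stabiliserE :
  column_stabiliser n la = [set 1%g; tperm ord0 ord_max].
Proof.
apply/setP=> q; rewrite !inE; apply/forallP/orP => [stab | [] /eqP-> i].
- have offE i : reshape_offset la (q i) = reshape_offset la i by exact/eqP.
  have fix_mid i : i != ord0 -> i != ord_max -> q i = i.
    move=> i0 im; have := offE i; rewrite !reshape_offset_la (negPf im).
    case: eqP => [_ /esym/eqP | _ /val_inj //].
    by rewrite -[0%N]/(val (@ord0 m.+1)) val_eqE (negPf i0).
  have fix_ends i : (i == ord0) || (i == ord_max) ->
      (q i == ord0) || (q i == ord_max).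
    move=> /orP[]/eqP def_i; have := offE i; rewrite !reshape_offset_la def_i.
      by case: (q ord0 =P ord_max) => [-> | _ /val_inj->]; rewrite ?eqxx ?orbT.
    rewrite eqxx.
    case: (q ord_max =P ord_max) => [-> | _ /(@val_inj _ _ _ _ ord0)->].
      by rewrite ?eqxx ?orbT.
    by rewrite eqxx.
  have ends_max : (@ord_max m.+1 == ord0) || (@ord_max m.+1 == ord_max).
    by rewrite eqxx orbT.
  have /orP[/eqP q0 | /eqP q0] := fix_ends ord0 isT; [left | right].
    have /orP[/eqP qm | /eqP qm] := fix_ends ord_max ends_max.
      by have /perm_inj := etrans qm (esym q0).
    apply/eqP/permP=> i; rewrite perm1.
    have [-> // | i0] := eqVneq i ord0; have [-> // | im] := eqVneq i ord_max.
    exact: fix_mid.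
  have qm : q ord_max = ord0.
    have /orP[/eqP // | /eqP qm] := fix_ends ord_max ends_max.
    by have /perm_inj := etrans qm (esym q0).
  apply/eqP/permP=> i; case: tpermP => [-> // | -> // | i0 im].
  by apply: fix_mid; apply/eqP.
- by rewrite perm1.
rewrite !reshape_offset_la.
by case: tpermP => [-> | -> | ]; rewrite ?eqxx.
Qed.

Lemma polytabloid0E : polytabloid0 F n la =
  delta_mx 0 (enum_rank (singleton_tabloid ord_max))
    - delta_mx 0 (enum_rank (singleton_tabloid ord0)).
Proof.
rewrite /polytabloid0 column_stabiliserE.
have ne1 : 1%g != tperm ord0 ord_max :> 'S_n.
  apply/eqP=> /permP/(_ ord0); rewrite perm1 tpermL => /eqP.
  by rewrite -val_eqE.
rewrite big_setU1 ?inE //= big_set1 odd_perm1 odd_tperm expr0 scale1r.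
rewrite -val_eqE /= expr1 scaleN1r tabloid0E !act_singleton_tabloid.
by rewrite perm1 tpermR.
Qed.
(** The Specht module is the image under [M] of the vectors with coordinate sum 0 in the permutation
    module; the quotient by these vectors is trivial, which accounts for the -1. *)
Lemma mxtrace_specht_standard (s : 'S_n) :
  \tr (specht F n la s) = #|[set i | s i == i]|%:R - 1.
Proof.
pose E (i : 'I_n) : 'rV[F]_#|{: 'I_n}| := delta_mx 0 (enum_rank i).
pose D i : 'rV[F]_#|{: (size la).-tuple {set 'I_n}}| :=
  delta_mx 0 (enum_rank (singleton_tabloid i)).
pose M := \matrix_(j < #|{: 'I_n}|) D (enum_val j).
have EM i : E i *m M = D i by rewrite -rowE rowK enum_rankK.
have rowE' m' (A : 'M[F]_(#|{: 'I_n}|, m')) j : row j A = E (enum_val j) *m A.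
  by rewrite /E enum_valK -rowE.
have homM t : t \in [set: 'S_n] -> rN t *m M = M *m rT t.
  move=> _; apply/row_matrixP=> j; rewrite !rowE' !mulmxA EM !delta_perm_repr.
  by rewrite EM /D act_singleton_tabloid.
have freeM : row_free M.
  apply/row_freeP; exists M^T; apply/matrixP=> j l; rewrite !mxE.
  rewrite (bigD1 (enum_rank (singleton_tabloid (enum_val j)))) //= big1.
    rewrite !mxE !eqxx mul1r addr0 (inj_eq enum_rank_inj).
    by rewrite (inj_eq singleton_tabloid_inj) (inj_eq enum_val_inj).
  by move=> t; rewrite !mxE eqxx eq_sym /= => /negPf->; rewrite mul0r.
pose f := const_mx 1 : 'M[F]_(#|{: 'I_n}|, 1).
pose r1 := triv_grepr F [set: 'S_n]%G.
have homf t : t \in [set: 'S_n] -> rN t *m f = f *m r1 t.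
  move=> _; rewrite mulmx1; apply/matrixP=> i j.
  by rewrite mul_perm_repr_mx !mxE.
have modK : mxmodule rN (kermx f).
  apply/mxmoduleP=> t Gt; apply/sub_kermxP.
  by rewrite -mulmxA homf // mulmxA mulmx_ker mul0mx.
have fullf : (1%:M :=: f)%MS.
  apply/eqmxP; rewrite submx1 andbT sub1mx /row_full -mxrank_tr rank_rV.
  rewrite -[0]trmx0 (inj_eq trmx_inj); apply/eqP; case: eqP => // f0.
  move/matrixP/(_ (enum_rank ord0) 0)/eqP: f0.
  by rewrite !mxE oner_eq0.
have := mxtrace_ker_im modK (mxmodule1 r1) homf fullf (in_setT s).
have tr1 : \tr (r1 s) = 1 by rewrite /= mxtrace1.
rewrite mxtrace_perm_repr (mxtrace_submod1 (mxmodule1 r1)) ?in_setT // tr1.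
move/eqP; rewrite -subr_eq => /eqP trK; rewrite trK => {trK}.
pose h := val_submod (U := kermx f) 1%:M *m M.
have defh : (h :=: kermx f *m M)%MS by apply/eqmxMr/val_submod1.
pose U := cyclic_mx rT (polytabloid0 F n la).
have modU : mxmodule rT U by apply: cyclic_mx_module.
have UD i : (D i - D ord_max <= U)%MS.
  have [-> | im] := eqVneq i ord_max; first by rewrite subrr sub0mx.
  (* The transposition of [ord0] and [i] moves the generator to [D ord_max - D i]. *)
  have -> : D i - D ord_max = - (polytabloid0 F n la *m rT (tperm ord0 i)).
    rewrite polytabloid0E mulmxBl !delta_perm_repr !act_singleton_tabloid.
    by rewrite tpermL tpermD ?opprB // eq_sym.
  rewrite eqmx_opp; apply: mxmodule_trans => //; exact: cyclic_mx_id.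
have defU : (U :=: h)%MS.
  apply: eqmx_trans (eqmx_sym defh); apply/eqmxP/andP; split.
    apply: cyclic_mx_sub.
      apply/mxmoduleP=> t Gt; rewrite -mulmxA -homM // mulmxA.
      by apply: submxMr; apply: (mxmoduleP modK).
    rewrite polytabloid0E -/(D ord_max) -/(D ord0) -!EM -mulmxBl submxMr //.
    apply/sub_kermxP; rewrite mulmxBl -!rowE; apply/rowP=> j.
    by rewrite !mxE subrr.
  apply/row_subP=> j; rewrite row_mul; move: (row j _) (row_sub j (kermx f)).
  move=> v /sub_kermxP vf.
  (* As the coordinates of [v] sum to 0, subtracting [D ord_max] from every [D i] changes
     nothing. *)
  have -> : v *m M = \sum_i v 0 (enum_rank i) *: (D i - D ord_max).
    under eq_bigr => i _ do rewrite scalerBr.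
    rewrite sumrB -scaler_suml.
    have -> : \sum_i v 0 (enum_rank i) = 0.
      move/rowP/(_ 0): vf; rewrite !mxE => vf0.
      rewrite -[RHS]vf0 [RHS](reindex enum_rank) /=; last first.
        exact/onW_bij/enum_rank_bij.
      by apply: eq_bigr => i _; rewrite mxE mulr1.
    rewrite scale0r subr0 mulmx_sum_row.
    rewrite [LHS](reindex enum_rank) /=; last exact/onW_bij/enum_rank_bij.
    by apply: eq_bigr => i _; rewrite rowK enum_rankK.
  by apply: summx_sub => i _; apply: scalemx_sub.
have homh t : t \in [set: 'S_n] -> submod_repr modK t *m h = h *m rT t.
  move=> Gt; have := val_submodJ modK 1%:M Gt; rewrite mul1mx val_submodE /h.
  move: (val_submod 1%:M) => W homW; rewrite mulmxA -[RHS]mulmxA -homM //.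
  by rewrite mulmxA -homW.
have ker0 : kermx h = 0.
  apply/eqP; rewrite kermx_eq0 /row_free mxrankMfree //.
  by rewrite val_submod1.
have modh : mxmodule (submod_repr modK) (kermx h) by rewrite ker0 mxmodule0.
rewrite (mxtrace_ker_im modh modU homh defU (in_setT s)).
by rewrite (mxtrace_submod0 _ _ ker0) add0r.
Qed.

End StandardSpecht.

(** * The alternating number of chains of fixed words *)

Section CountSuperwords.

Variables (R : comNzRingType) (X : finType) (L : {set X}).

Fixpoint words_over m : seq (seq X) :=
  if m is m'.+1 then [seq a :: t | a <- enum L, t <- words_over m']
  else [:: [::]].

Lemma mem_words_over m t :
  (t \in words_over m) = (size t == m) && all [in L] t.
Proof.
elim: m t => [|m IHm] [|a t] //=.
  by apply/negbTE/allpairsP=> -[[b s] []].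
rewrite eqSS.
apply/allpairsP/idP => [[[b s] [/= Lb ss [-> ->]]] | /and3P[st La Lt]].
  by move: Lb ss; rewrite mem_enum IHm => -> /andP[-> ->].
by exists (a, t); rewrite /= mem_enum La IHm st Lt.
Qed.

Lemma words_over_uniq m : uniq (words_over m).
Proof.
elim: m => //= m IHm; apply: allpairs_uniq => //; first exact: enum_uniq.
by move=> [a s] [b t] _ _ /= [-> ->].
Qed.

(** Evaluation at 1 adds up the coefficients left by [drop_poly], those of index at least [l]. *)
Definition tail_sum l (p : {poly R}) := (drop_poly l p).[1].

Lemma tail_sumD l p q : tail_sum l (p + q) = tail_sum l p + tail_sum l q.
Proof. by rewrite /tail_sum drop_polyD hornerD. Qed.

Lemma tail_sumZ l c p : tail_sum l (c *: p) = c * tail_sum l p.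
Proof. by rewrite /tail_sum drop_polyZ hornerZ. Qed.

Lemma tail_sum0 l : tail_sum l 0 = 0.
Proof. by rewrite /tail_sum drop_poly0r horner0. Qed.

Lemma tail_sumMX l p : tail_sum l (p * 'X) = tail_sum l.-1 p.
Proof.
rewrite /tail_sum -['X]expr1 drop_polyMXn subn1 hornerM hornerXn expr1n.
by rewrite mulr1.
Qed.

Lemma tail_sumXn l m : tail_sum l 'X^m = (l <= m)%N%:R.
Proof.
elim: m l => [|m IHm] l; last first.
  by rewrite exprSr tail_sumMX IHm; case: l.
case: l => [|l]; first by rewrite /tail_sum drop_poly0l expr0 hornerC.
by rewrite /tail_sum drop_poly_eq0 ?horner0 // expr0 size_poly1.
Qed.

Local Notation q := (#|L|%:R - 1 : R).

(** Greedy matching on the first letter of [t]: if it is the first letter of [x], that letter is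
    used up, which is the factor ['X]; each of the [q] other letters leaves [x] unchanged. *)
Lemma sum_superwords m x : all [in L] x ->
  \sum_(t <- words_over m) (subseq x t)%:R =
    tail_sum (size x) (('X + q%:P) ^+ m) :> R.
Proof.
elim: m x => [|m IHm] x Lx.
  rewrite big_seq1 expr0 -(expr0 'X) tail_sumXn leqn0.
  by case: x {Lx}.
rewrite big_allpairs_dep exprSr mulrDr tail_sumD tail_sumMX mulrC mul_polyC.
rewrite tail_sumZ /=; case: x Lx => [_ | b x /= /andP[Lb Lx]].
  have IH : \sum_(t <- words_over m) 1 = tail_sum 0 (('X + q%:P) ^+ m).
    by rewrite -(IHm [::]) //; apply: eq_bigr => t _; rewrite sub0seq.
  rewrite big_enum /= (eq_bigr (fun=> tail_sum 0 (('X + q%:P) ^+ m))) => [|a _].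
    rewrite sumr_const /=; move: (tail_sum 0 _) => T.
    by rewrite mulrBl mul1r addrC subrK mulr_natl.
  exact: IH.
rewrite big_enum (bigD1 b) //= eqxx IHm //; congr (_ + _).
under eq_bigr => a /andP[_ /negPf ne_ab].
  rewrite eq_sym ne_ab IHm /= ?Lb //.
  over.
rewrite sumr_const /=; move: (tail_sum _ _) => T.
have -> : q = #|[predD1 L & b]|%:R.
  by rewrite (cardD1 b L) Lb natrD addrAC subrr add0r.
rewrite mulr_natl; congr (_ *+ _).
by apply: eq_card => a; rewrite !inE andbC.
Qed.

Lemma tail_sum_comp l (h : {poly R}) K : (size h <= K)%N ->
  tail_sum l (h \Po ('X + q%:P)) =
    \sum_(m < K) h`_m * tail_sum l (('X + q%:P) ^+ m).
Proof.
move=> hK; rewrite comp_polyE.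
rewrite (big_ord_widen K (fun i => h`_i *: ('X + q%:P) ^+ i)) // big_mkcond.
rewrite (big_morph _ (tail_sumD l) (tail_sum0 l)); apply: eq_bigr => i _.
case: ltnP => hi; first by rewrite tail_sumZ.
by rewrite tail_sum0 nth_default ?mul0r.
Qed.

End CountSuperwords.

(** * The closed form of the alternating count *)

Section ClosedForm.

Variables (R : comNzRingType) (q : R) (k r : nat).
Hypothesis rk : (1 <= r <= k)%N.

(* The alternating numbers of chains above a word of length [l], as the
   coefficients of a polynomial; without deleted rank it is (X - q)^k, and the
   coefficient [c] makes the coefficient at the deleted rank [r] vanish. *)
Definition chain_poly : {poly R} := let c := (('X - q%:P) ^+ k)`_r in
  ('X - q%:P) ^+ k - c *: ('X - q%:P) ^+ r + c *: ('X - q%:P) ^+ r.-1.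

Lemma chain_poly_r : chain_poly`_r = 0.
Proof.
case/andP: rk => r_gt0 _; rewrite !coefD coefN !coefZ.
have := monicP (monic_exp r (monicXsubC q)).
rewrite lead_coefE size_exp_XsubC => ->.
rewrite [X in _ + _ * X]nth_default ?size_exp_XsubC ?prednK //.
by rewrite mulr1 subrr mulr0 addr0.
Qed.

Lemma size_chain_poly : (size chain_poly <= k.+1)%N.
Proof.
case/andP: rk => r_gt0 r_le; rewrite /chain_poly.
apply: leq_trans (size_polyD _ _) _; rewrite geq_max; apply/andP; split.
  apply: leq_trans (size_polyD _ _) _; rewrite size_polyN geq_max.
  rewrite size_exp_XsubC leqnn; apply: leq_trans (size_scale_leq _ _) _.
  by rewrite size_exp_XsubC ltnS.
apply: leq_trans (size_scale_leq _ _) _; rewrite size_exp_XsubC ltnS.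
exact: leq_trans (leq_pred _) _.
Qed.

(** Substituting ['X + q] leaves ['X^k - c 'X^r + c 'X^r.-1]; for [l != r] the last two terms both
    count or both do not, so they cancel. *)
Lemma tail_sum_chain_poly l : (l <= k)%N -> l != r ->
  tail_sum l (chain_poly \Po ('X + q%:P)) = 1.
Proof.
case/andP: rk => r_gt0 r_le lk lr.
have subX m : ('X - q%:P) ^+ m \Po ('X + q%:P) = 'X^m.
  by rewrite rmorphXn /= comp_polyB comp_polyX comp_polyC addrK.
rewrite /chain_poly comp_polyD comp_polyB !comp_polyZ !subX.
rewrite -scaleNr !tail_sumD !tail_sumZ !tail_sumXn lk.
have -> : (l <= r.-1)%N = (l <= r)%N.
  by rewrite -ltnS prednK // ltn_neqAle lr.
by rewrite mulNr addrNK.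
Qed.

(** The constant coefficient is the value at 0, with [c = 'C(k, r) * (- q) ^+ (k - r)] by the
    binomial theorem. *)
Lemma chain_poly0 : chain_poly`_0 =
  (-1) ^+ k.-1 * (('C(k, r) - 1)%N%:R * q ^+ k + 'C(k, r)%:R * q ^+ k.-1).
Proof.
case/andP: rk => r_gt0 r_le; have k_gt0 := leq_trans r_gt0 r_le.
have coef_r : (('X - q%:P) ^+ k)`_r = 'C(k, r)%:R * (- q) ^+ (k - r).
  rewrite -polyCN addrC exprDn coef_sum.
  rewrite (bigD1 (Ordinal (r_le : r < k.+1)%N)) //=.
  rewrite big1 ?addr0 => [|i ne_ir];
    rewrite coefMn -polyC_exp mul_polyC coefZ coefXn.
    by rewrite eqxx mulr1 mulr_natl.
  by rewrite eq_sym [_ == _](negPf ne_ir) mulr0 mul0rn.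
have e_k : (k - r + r.-1 = k.-1)%N.
  by rewrite -!subn1 addnBA // subnK.
rewrite -horner_coef0 /chain_poly coef_r !hornerE.
rewrite -!mulrA -!exprD subnK // e_k natrB ?bin_gt0 // -(prednK k_gt0) /=.
rewrite !exprS [(- q) ^+ _]exprNn; ring.
Qed.

End ClosedForm.

Section FixedChains.

Variables (n k r : nat) (L : {set 'I_n}).
Let S := [pred i : nat | (1 <= i <= k)%N && (i != r)].
Local Notation P := (words n k S).

Definition over_L (w : P) := all [in L] (letters w).

(** Chains are counted by their least element; [x] is a bare word, so it may be the empty word,
    which is not in the poset. *)
Fixpoint count_above m (x : seq 'I_n) : nat :=
  if m is m'.+1 then
    \sum_(y : P | over_L y && ltw x (letters y)) count_above m' (letters y)
  else 1.

Lemma sum_chains_above m x :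
  (\sum_(t : m.-tuple P | [&& sorted <%O t, all over_L t
                            & all (fun y => ltw x (letters y)) t]) 1
     = count_above m x)%N.
Proof.
elim: m x => [|m IHm] x.
  by rewrite (big_pred1 [tuple]) // => t; rewrite tuple0.
pose cons_pair (p : P * m.-tuple P) := [tuple of p.1 :: p.2].
rewrite (reindex cons_pair) /=; last first.
  exists (fun t => (thead t, [tuple of behead t])) => [[y t] _ | t _] /=.
    by rewrite /cons_pair theadE; congr (_, _); apply: val_inj.
  by rewrite /cons_pair -tuple_eta.
pose Q (y : P) (t : m.-tuple P) := [&& sorted <%O t, all over_L t
  & all (fun z => ltw (letters y) (letters z)) t].
rewrite (eq_bigl (fun p : P * m.-tuple P =>
    (over_L p.1 && ltw x (letters p.1)) && Q p.1 p.2)); last first.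
  move=> [y t]; rewrite /cons_pair /= /Q path_sortedE; last exact: lt_trans.
  have -> : all (> y)%O t = all (fun z => ltw (letters y) (letters z)) t.
    by apply: eq_all => z; rewrite ltw_letters.
  case xy: (ltw x (letters y)); last by rewrite !andbF.
  case: (over_L y); last by rewrite !andbF.
  case yt: (all (fun z => ltw (letters y) _) t); last by rewrite !andbF.
  have -> : all (fun z => ltw x (letters z)) t.
    by apply: sub_all yt => z; apply: ltw_trans xy.
  by rewrite !andbT.
transitivity (\sum_(y | over_L y && ltw x (letters y)) \sum_(t | Q y t) 1)%N.
  by rewrite pair_big_dep.
by apply: eq_bigr => y _; apply: IHm.
Qed.

Variable R : comNzRingType.
Hypothesis rk : (1 <= r <= k)%N.
Local Notation h := (chain_poly (#|L|%:R - 1 : R) k r).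

(** Over all words above [x] of length up to [k], the coefficients add up to a tail sum, which is 1.
    The term of [x] itself moves to the right, and words of length [r] contribute 0 since that
    coefficient of [h] vanishes. *)
Lemma sum_chain_poly_above x :
    all [in L] x -> (size x <= k)%N -> size x != r ->
  \sum_(y : P | over_L y && ltw x (letters y)) h`_(size (letters y)) =
    1 - h`_(size x).
Proof.
move=> Lx xk xr; pose s := flatten [seq words_over L m | m <- iota 0 k.+1].
have sP t : (t \in s) = (size t <= k)%N && all [in L] t.
  apply/flatten_mapP/andP => [[m] | [tk Lt]].
    rewrite mem_iota ltnS mem_words_over => mk /andP[/eqP-> ->].
    by split.
  by exists (size t); rewrite ?mem_iota ?ltnS ?mem_words_over ?eqxx.
have sU : uniq s.
  rewrite /s; move: {1}0%N k.+1 => j l; elim: l j => //= l IHl j.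
  rewrite cat_uniq words_over_uniq IHl andbT; apply/hasPn => t.
  case/flatten_mapP=> m; rewrite mem_iota mem_words_over => /andP[jm _].
  by case/andP=> /eqP szt _; rewrite mem_words_over szt gtn_eqF.
have sum_s : \sum_(t <- s | subseq x t) h`_(size t) = 1.
  rewrite -[RHS](tail_sum_chain_poly (#|L|%:R - 1) rk xk xr).
  rewrite (tail_sum_comp _ _ (size_chain_poly _ rk)) /s big_flatten big_map.
  rewrite -[iota 0 _]/(index_iota 0 k.+1) big_mkord; apply: eq_bigr => m _.
  rewrite -sum_superwords // mulr_sumr big_mkcond big_seq [RHS]big_seq.
  apply: eq_bigr => t; rewrite mem_words_over => /andP[/eqP-> _].
  by case: ifP; rewrite ?mulr1 ?mulr0.
have xs : x \in s by rewrite sP xk.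
rewrite -[X in X - h`_(size x)]sum_s [X in X - _]big_mkcond.
rewrite [X in X - _](bigD1_seq x) //= subseq_refl addrAC subrr add0r.
rewrite -[RHS]big_mkcondr.
have -> : \sum_(t <- s | (t != x) && subseq x t) h`_(size t) =
    \sum_(t <- s | (size t \in S) && ltw x t) h`_(size t).
  rewrite [LHS]big_seq_cond [RHS]big_seq_cond big_mkcond [RHS]big_mkcond.
  apply: eq_bigr => t _; case: (size t =P r) => [-> | /eqP tr].
    by rewrite (chain_poly_r _ rk) !if_same.
  congr (if _ then _ else _); rewrite sP; apply: andb_id2l => /andP[tk _].
  rewrite andbC eq_sym; apply/esym/andb_idl => /andP[xt ne_xt].
  rewrite inE tk tr !andbT lt0n size_eq0; apply: contraNneq ne_xt => t0.
  by move: xt; rewrite t0 subseq0.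
rewrite -[LHS]big_filter -[RHS]big_filter; set e := filter _ _.
transitivity (\sum_(t <- map letters e) h`_(size t)); first by rewrite big_map.
apply: perm_big; apply: uniq_perm.
- by rewrite (map_inj_uniq letters_inj) filter_uniq // index_enum_uniq.
- by rewrite filter_uniq.
move=> t; rewrite mem_filter sP.
apply/mapP/andP => [[y] | [/andP[St xt] /andP[_ Lt]]].
  rewrite mem_filter => /andP[/andP[Ly xy] _] ->; rewrite size_letters xy.
  split=> //; rewrite [all _ _]Ly andbT.
  by case/andP: (size_letters y) => /andP[].
have [y def_t] := letters_codom St; exists y => //.
by rewrite mem_filter mem_index_enum /over_L -def_t Lt xt.
Qed.

(** Both sides satisfy the recursion [a x = 1 - \sum_(y > x) a y], by splitting off the least
    element of a chain. The bound on [m] ensures that all chains above [x] are counted. *)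
Lemma sum_chains_alternating m x :
    all [in L] x -> (size x <= k)%N -> size x != r -> (k - size x < m)%N ->
  \sum_(j < m) (-1) ^+ j * (count_above j x)%:R = h`_(size x).
Proof.
elim: m x => // m IHm x Lx xk xr km; rewrite big_ord_recl mul1r /=.
rewrite -[RHS](subKr 1) -sum_chain_poly_above // -sumrN; congr (_ + _).
under eq_bigr => j _.
  rewrite exprS mulN1r mulNr natr_sum mulr_sumr -sumrN; over.
rewrite exchange_big; apply: eq_bigr => y /andP[Ly xy]; rewrite sumrN /=.
have := size_letters y; rewrite inE => /andP[/andP[y_gt0 yk] yr].
congr (- _); apply: IHm => //.
have := ltw_size xy => xy'; rewrite -ltnS; apply: leq_trans km.
by rewrite ltnS ltn_sub2l // (leq_trans xy').
Qed.

End FixedChains.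

Section FixedChainTrace.

Variables (F : fieldType) (n k r : nat) (s : 'S_n).
Let S := [pred i : nat | (1 <= i <= k)%N && (i != r)].

(** The action is entrywise, so a chain is fixed only if each of its words is, that is, if all their
    letters are fixed points. Every word of the poset is nonempty, hence above [[::]]. *)
Lemma mxtrace_chain_repr m :
  \tr (chain_repr F (@word_action_mono n k S) m s) =
    (@count_above n k r [set i | s i == i] m [::])%:R.
Proof.
rewrite mxtrace_perm_repr -sum_chains_above sum1_card; congr (_%:R).
rewrite -(card_imset _ val_inj); apply: eq_card => t.
have map_id_all (T : eqType) (f : T -> T) (c : seq T) :
    (map f c == c) = all (fun x => f x == x) c.
  by elim: c => //= x c <-; rewrite eqseq_cons.
have fixE (c : chain (words n k S) m) :
    (chain_action (@word_action_mono n k S) m c s == c) =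
    all (@over_L n k r [set i | s i == i]) (val (val c)).
  rewrite -(inj_eq val_inj) -(inj_eq val_inj) /= map_id_all.
  apply: eq_all => w; rewrite -(inj_eq val_inj) -(inj_eq val_inj) /= map_id_all.
  by apply: eq_all => i; rewrite inE.
apply/imsetP/idP => [[c] | /and3P[srt Lt _]].
  rewrite inE fixE => fix_c ->; rewrite unfold_in; apply/and3P; split=> //.
    exact: (valP c).
  apply/allP=> w _; rewrite ltw_nil; have := size_letters w.
  by case/andP=> /andP[].
by exists (exist _ t srt); rewrite // inE fixE.
Qed.

(** The lengths along a chain are distinct and avoid [r], which leaves only [k.-1] values. *)
Lemma card_chain_top : (1 <= r <= k)%N -> #|{: chain (words n k S) k}| = 0%N.
Proof.
move=> rk; apply: eq_card0 => c; apply/negP=> _.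
pose l := [seq size (letters w) | w <- val (val c)].
have l_uniq : uniq l.
  apply: (sorted_uniq ltn_trans ltnn).
  have := valP c; rewrite /l sorted_map; apply: sub_sorted => u v.
  by rewrite -ltw_letters; apply: ltw_size.
have : {subset l <= rem r (iota 1 k)}.
  move=> i /mapP[w _ ->]; have := size_letters w; rewrite inE => /andP[wk wr].
  by rewrite mem_rem_uniq ?iota_uniq // !inE wr mem_iota add1n ltnS.
move/(uniq_leq_size l_uniq); rewrite size_map size_tuple size_rem ?size_iota.
  by case: k rk => [|k'] => [/andP[/leq_trans le /le] | _]; rewrite ?ltnn.
by rewrite mem_iota add1n ltnS.
Qed.

End FixedChainTrace.

(** * Traces of sums and tensor powers, and the conclusion *)

Section TraceConstructions.

Variables (F : fieldType) (gT : finGroupType) (G : {group gT}).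

Lemma mxtrace_dadd_grepr (V W : representation F G) g :
  \tr (dadd_grepr V W g) = \tr (V g) + \tr (W g).
Proof. exact: mxtrace_block. Qed.

Lemma mxtrace_muln_grepr (V : representation F G) k g :
  \tr (muln_grepr V k g) = \tr (V g) *+ k.
Proof.
rewrite /muln_grepr (big_morph (fun W : representation F G => \tr (W g))
  (id1 := 0) (op1 := +%R)) ?mxtrace1 //.
  by rewrite sumr_const card_ord.
by move=> V1 V2; apply: mxtrace_dadd_grepr.
Qed.

Lemma mxtrace_tens_grepr (V : representation F G) k g :
  \tr (tens_grepr V k g) = \tr (V g) ^+ k.
Proof.
elim: k => [|k IHk] /=; first by rewrite mxtrace1.
by rewrite mxtrace_prod IHk exprS.
Qed.

End TraceConstructions.

Theorem theorem18 (R : realType) (n k r : nat)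
    (hn : (2 <= n)%N) (hk : (1 <= k)%N) (hr : (1 <= r <= k)%N) :
  let S := [pred i : nat | (1 <= i <= k)%N && (i != r)] in
  let V := specht R[i] n [:: n.-1; 1%N] in
  mx_rsim
    (reduced_homology_repr R[i] (@word_action_mono n k S) k.-1)
    (dadd_grepr (muln_grepr (tens_grepr V k) ('C(k, r) - 1)%N)
                (muln_grepr (tens_grepr V k.-1) 'C(k, r))).
Proof.
case: n hn => [|[|m]] // _ S V.
apply: mx_rsim_mxtrace; first exact: Num.Theory.pchar_num.
move=> s _; rewrite mxtrace_dadd_grepr !mxtrace_muln_grepr !mxtrace_tens_grepr.
rewrite mxtrace_specht_standard.
set L := [set i | s i == i]; set q : R[i] := #|L|%:R - 1.
(* Degree k - 2 means faces with [k.-1] vertices, the largest size a chain can have. *)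
rewrite mxtrace_reduced_homology; first last.
- by move=> j jk; apply: words_boundary_exact.
- by rewrite prednK //; apply: card_chain_top.
rewrite prednK //; under eq_bigr => j _.
  rewrite exprD -mulrA mxtrace_chain_repr -/L; over.
rewrite -mulr_sumr.
(* At the empty word the alternating sum is taken with [k.+1] terms; the last is zero because no
   chain has [k] elements. *)
have := @sum_chains_alternating m.+2 k r L R[i] hr k.+1 [::] isT (leq0n k).
rewrite eq_sym -lt0n subn0 ltnSn => /(_ (proj1 (andP hr)) isT).
have no_top : #|{: chain (words m.+2 k S) k}| = 0%N by apply: card_chain_top.
rewrite big_ord_recr /= -mxtrace_chain_repr mxtrace_perm_repr.
rewrite (_ : #|[set x | _]| = 0%N) ?mulr0 ?addr0; last first.
  apply/eqP; rewrite -leqn0; apply: leq_trans (max_card _) _.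
  by rewrite no_top.
(* The sign from the Hopf trace formula cancels the sign in [chain_poly0]. *)
by move=> ->; rewrite chain_poly0 // mulrA -expr2 sqrr_sign mul1r !mulr_natl.
Qed.
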